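(* Let $n\ge1$, $\mu=(\mu_1,\dots,\mu_n)\in\mathbb R^n$, and $H_\mu=J+V_\mu$ with $V_\mu=\mathrm{diag}(2\mu_1,\mu_2,\dots,\mu_n,0,0,\dots)$. Suppose that $H_\mu$ has a virtual level at its right threshold $\lambda=4$. Then there is a unique $\ell$, $0\le\ell\le n-1$, such that $$-\mu\in\mathrm{Graph}\big((\Phi_{n-1}+1)|_{D_\ell^{(n-1)}}\big).$$ In this case, $H_\mu$ has a threshold resonance at $\lambda=4$ and exactly $\ell$ simple eigenvalues on the semi-axis $(4,\infty)$.
   Context: The free Jacobi operator $J$ on $\ell^2(\mathbb N)$, $\mathbb N=\{1,2,\dots\}$, is given by the tridiagonal matrix with diagonal entries all equal to $2$ and off-diagonal entries $a_1=-\sqrt2$, $a_k=-1$ ($k\ge2$), where $a_k$ is the $(k,k+1)$ and $(k+1,k)$ entry; its spectrum is $[0,4]$. $H_\mu$ has a virtual level at the right threshold $4$ if it is critical there, i.e. the function $\nu\mapsto\mathrm{tr}\,E_{H_\nu}((4,\infty))$ on $\mathbb R^n$ is discontinuous at $\nu=\mu$, where $E_A$ is the spectral measure of a self-adjoint operator $A$. A threshold resonance (virtual state) at $\lambda=4$ is a nonzero bounded sequence $\Psi=\{\Psi_k\}_{k\ge1}$ solving $H_\mu\Psi=4\Psi$ entrywise. Let $Q_0=1$, $Q_1=1+\mu_1$, $Q_{n+1}=(2+\mu_{n+1})Q_n-Q_{n-1}$ for $n\ge1$, and $\Phi_n=Q_{n-1}/Q_n-2$ on $\mathrm{Dom}(\Phi_n)=\{\mu\in\mathbb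 R^n:Q_n(\mu)\ne0\}$, $n\ge1$. For a real function $f$, $\mathrm{epi}(f)=\{(x,y)\in\mathrm{Dom}(f)\times\mathbb R: y>f(x)\}$ and $\mathrm{hypo}(f)=\{(x,y)\in\mathrm{Dom}(f)\times\mathbb R: y<f(x)\}$. The subsets $D_k^{(n)}\subset\mathrm{Dom}(\Phi_n)$, $0\le k\le n$, are defined inductively, with $\Gamma_k^{(n)}\subset\mathbb R^{n+1}$ the graph of $\Phi_n|_{D_k^{(n)}}$. Convention for $n=0$: $D_0^{(0)}=\mathbb R^0$ is a point, $\Phi_0=-1$, $\Gamma_0^{(0)}=\{-1\}\subset\mathbb R$. For $n=1$: $D_0^{(1)}=(-1,\infty)$, $D_1^{(1)}=(-\infty,-1)$. For $n\ge1$: $D_0^{(n+1)}=\mathrm{epi}(\Phi_n|_{D_0^{(n)}})$, $D_{n+1}^{(n+1)}=\mathrm{hypo}(\Phi_n|_{D_n^{(n)}})$, and for $1\le k\le n$, $D_k^{(n+1)}=\mathrm{hypo}(\Phi_n|_{D_{k-1}^{(n)}})\cup(\Gamma_{k-1}^{(n-1)}\times\mathbb R)\cup\mathrm{epi}(\Phi_n|_{D_k^{(n)}})$. (These are the $n+1$ connected components of $\mathrm{Dom}(\Phi_n)$.) *)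

(* Defs.v *)
From HB Require Import structures.
From mathcomp Require Import all_boot all_order all_algebra.
From mathcomp Require Import complex.
From mathcomp Require Import all_classical all_reals all_analysis.
From mathcomp Require Import ring lra.

Set Implicit Arguments.
Unset Strict Implicit.
Unset Printing Implicit Defensive.

Import Order.TTheory GRing.Theory Num.Theory.
Import numFieldNormedType.Exports.

Local Open Scope classical_set_scope.
Local Open Scope ring_scope.
Local Open Scope complex_scope.

(* Sequences are indexed from 0: entry k is the (k+1)-st entry of the
   1-based mathematical notation, both for l^2(N) and for row vectors. *)

Section ell2.
Context {R : realType}.
Implicit Types x y : nat -> R[i].

Definition l2 x : Prop :=
  (\sum_(k <oo) (complex.Re (x k) ^+ 2 + complex.Im (x k) ^+ 2)%:E < +oo)%E.

(* antilinear in the first argument; the series is summed componentwise *)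
Definition dot x y : R[i] :=
  limn (series (fun k => complex.Re (conjc (x k) * y k)))
    +i* limn (series (fun k => complex.Im (conjc (x k) * y k))).

Definition basis (j : nat) : nat -> R[i] := fun k => (k == j)%:R.

Definition lincomb (c : R[i]) x y : nat -> R[i] := fun k => c * x k + y k.

(* Operators on l^2(N) are functions on all sequences, of which only the
   restriction to l2 is ever constrained or used. *)
Definition orthogonal_projection (P : (nat -> R[i]) -> nat -> R[i]) : Prop :=
  [/\ forall x, l2 x -> l2 (P x),
      forall c x y, l2 x -> l2 y -> P (lincomb c x y) = lincomb c (P x) (P y),
      forall x y, l2 x -> l2 y -> dot (P x) y = dot x (P y)
    & forall x, l2 x -> P (P x) = P x].

(* E is the spectral measure of the everywhere defined bounded self-adjoint
   operator A: a projection-valued measure on the Borel sets of the line with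
   A = \int t dE(t).  Countable additivity and the integral are expressed
   through the scalar measures S |-> <x, E(S) x>; by polarization the quadratic
   form of A determines A, and the spectral theorem gives existence and
   uniqueness of E (on Borel sets and l2). *)
Definition is_spectral_measure (A : (nat -> R[i]) -> nat -> R[i])
    (E : set (measurableTypeR R) -> (nat -> R[i]) -> nat -> R[i]) : Prop :=
  [/\ forall S, measurable S -> orthogonal_projection (E S),
      forall x, l2 x -> E setT x = x,
      forall S T x, measurable S -> measurable T -> l2 x ->
        E (S `&` T) x = E S (E T x)
    & forall x, l2 x ->
        exists m : {measure set (measurableTypeR R) -> \bar R},
          [/\ forall S, measurable S -> m S = (complex.Re (dot x (E S x)))%:E,
              m.-integrable setT (fun t : measurableTypeR R => t%:E)
            & (complex.Re (dot x (A x)))%:E = (\int[m]_t t%:E)%E]].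

(* trace of a nonnegative operator *)
Definition trace (P : (nat -> R[i]) -> nat -> R[i]) : \bar R :=
  (\sum_(k <oo) (complex.Re (dot (basis k) (P (basis k))))%:E)%E.

Definition eigenvector (A : (nat -> R[i]) -> nat -> R[i]) (t : R) x : Prop :=
  [/\ l2 x, exists k, x k != 0 & A x = fun k => t%:C * x k].

Definition is_eigenvalue (A : (nat -> R[i]) -> nat -> R[i]) (t : R) : Prop :=
  exists x, eigenvector A t x.

Definition is_simple_eigenvalue (A : (nat -> R[i]) -> nat -> R[i]) (t : R) :
    Prop :=
  exists2 x, eigenvector A t x &
    forall y, eigenvector A t y -> exists c : R[i], y = fun k => c * x k.

End ell2.

Section jacobi.
Context {R : realType}.

(* extension of a row vector by zeros *)
Definition ext n (z : 'rV[R]_n) (k : nat) : R :=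
  if insub k is Some i then z ord0 i else 0.

(* the Jacobi matrix with diagonal b and off-diagonal a, acting entrywise on
   arbitrary sequences *)
Definition jacobi (a b : nat -> R) (x : nat -> R[i]) : nat -> R[i] :=
  fun k => (if k is k'.+1 then (a k')%:C * x k' else 0)
           + (b k)%:C * x k + (a k)%:C * x k.+1.

Definition free_offdiag (k : nat) : R := if k == 0%N then - Num.sqrt 2 else - 1.

Definition potential n (mu : 'rV[R]_n) (k : nat) : R :=
  if k == 0%N then 2 * ext mu 0 else ext mu k.

Definition H n (mu : 'rV[R]_n) : (nat -> R[i]) -> nat -> R[i] :=
  jacobi free_offdiag (fun k => 2 + potential mu k).

(* E nu ranges over the spectral measure of H nu, which exists and is unique. *)
Definition virtual_level_at_4 n (mu : 'rV[R]_n) : Prop :=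
  exists E : 'rV[R]_n -> set (measurableTypeR R) -> (nat -> R[i]) -> nat -> R[i],
    (forall nu, is_spectral_measure (H nu) (E nu)) /\
    ~ {for mu, continuous (fun nu => trace (E nu `]4, +oo[%classic))}.

Definition threshold_resonance_at_4 n (mu : 'rV[R]_n) : Prop :=
  exists psi : nat -> R[i],
    [/\ exists k, psi k != 0,
        exists M : R, forall k, `|psi k| <= M%:C
      & H mu psi = fun k => 4 * psi k].

End jacobi.

Section domains.
Context {R : realType}.

Fixpoint Qseq (m : nat -> R) (n : nat) : R :=
  match n with
  | 0 => 1
  | 1 => 1 + m 0
  | ((q.+1) as p).+1 => (2 + m p) * Qseq m p - Qseq m q
  end.

Definition Q n (z : 'rV[R]_n) : R := Qseq (ext z) n.

(* Q_{n-1}/Q_n - 2 for n >= 1, with domain Q n z != 0; each D n k below is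
   contained in this domain (D_sub_dom), so that division by 0 is not used *)
Definition Phi n (z : 'rV[R]_n) : R :=
  if n is p.+1 then Qseq (ext z) p / Q z - 2 else - 1.

Definition init n (z : 'rV[R]_n.+1) : 'rV[R]_n :=
  \row_(i < n) z ord0 (widen_ord (leqnSn n) i).

Definition lastc n (z : 'rV[R]_n.+1) : R := z ord0 ord_max.

(* epigraph, hypograph and graph of f restricted to A; a point (x, y) of
   R^n x R is the row vector z of size n+1 with init z = x, lastc z = y *)
Definition epi n (f : 'rV[R]_n -> R) (A : set 'rV[R]_n) : set 'rV[R]_n.+1 :=
  [set z | A (init z) /\ f (init z) < lastc z].

Definition hypo n (f : 'rV[R]_n -> R) (A : set 'rV[R]_n) : set 'rV[R]_n.+1 :=
  [set z | A (init z) /\ lastc z < f (init z)].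

Definition graph n (f : 'rV[R]_n -> R) (A : set 'rV[R]_n) : set 'rV[R]_n.+1 :=
  [set z | A (init z) /\ lastc z = f (init z)].

Definition D0 (k : nat) : set 'rV[R]_0 := if k == 0%N then setT else set0.

Definition D1 (k : nat) : set 'rV[R]_1 :=
  match k with
  | 0 => [set z | - 1 < z ord0 ord0]
  | 1 => [set z | z ord0 ord0 < - 1]
  | _ => set0
  end.

(* D^(n+2) from D' = D^(n) and D = D^(n+1) *)
Definition Dstep n (D' : nat -> set 'rV[R]_n) (D : nat -> set 'rV[R]_n.+1)
    (k : nat) : set 'rV[R]_n.+2 :=
  if k == 0%N then epi (@Phi n.+1) (D 0)
  else if k == n.+2 then hypo (@Phi n.+1) (D n.+1)
  else if (k <= n.+1)%N then
    hypo (@Phi n.+1) (D k.-1)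
    `|` [set z | graph (@Phi n) (D' k.-1) (init z)]
    `|` epi (@Phi n.+1) (D k)
  else set0.

(* the pair (D^(n), D^(n+1)) *)
Fixpoint Dpair (n : nat) :
    (nat -> set 'rV[R]_n) * (nat -> set 'rV[R]_n.+1) :=
  match n with
  | 0 => (D0, D1)
  | p.+1 => ((Dpair p).2, Dstep (Dpair p).1 (Dpair p).2)
  end.

Definition D (n k : nat) : set 'rV[R]_n := (Dpair n).1 k.
Arguments D n k _ : clear implicits.

Lemma D_rec n k : D n.+2 k = Dstep (D n) (D n.+1) k.
Proof. by []. Qed.

Lemma ext_init n (z : 'rV[R]_n.+1) k : (k < n)%N -> ext (init z) k = ext z k.
Proof.
move=> kn; rewrite /ext !insubT ?(leqW kn) //= => kn1.
by rewrite mxE; congr (z _ _); exact: val_inj.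
Qed.

Lemma ext_lastc n (z : 'rV[R]_n.+1) : ext z n = lastc z.
Proof.
rewrite /ext insubT //= => nn.
by rewrite /lastc; congr (z _ _); exact: val_inj.
Qed.

Lemma QseqSS (m : nat -> R) n :
  Qseq m n.+2 = (2 + m n.+1) * Qseq m n.+1 - Qseq m n.
Proof. by []. Qed.

Lemma eq_Qseq (m m' : nat -> R) n :
  (forall k, (k < n)%N -> m k = m' k) -> Qseq m n = Qseq m' n.
Proof.
elim/ltn_ind: n => -[|[|n]] IH mm' //; first by rewrite /= mm'.
rewrite !QseqSS mm' // (IH n) //; last first.
  by move=> k kn; apply: mm'; rewrite ltnW // ltnW.
by rewrite (IH n.+1) // => k kn; apply: mm'; exact: ltnW.
Qed.

Lemma QE n (z : 'rV[R]_n.+2) :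
  Q z = (2 + lastc z) * Q (init z) - Qseq (ext (init z)) n.
Proof.
rewrite {1}/Q QseqSS (ext_lastc z) /Q.
by congr (_ * _ - _); apply: eq_Qseq => k kn; rewrite ext_init // ltnW.
Qed.

Lemma Q_step n (z : 'rV[R]_n.+2) : Q (init z) != 0 ->
  lastc z != Phi (init z) -> Q z != 0.
Proof.
move=> Q0; apply: contraNN => /eqP; rewrite QE => e.
have {}e : (2 + lastc z) * Q (init z) = Qseq (ext (init z)) n.
  by apply/eqP; rewrite -subr_eq0 e.
by apply/eqP; rewrite /Phi -e mulfK // addrAC subrr add0r.
Qed.

Lemma Q_graph n (z : 'rV[R]_n.+2) : Q (init (init z)) != 0 ->
  lastc (init z) = Phi (init (init z)) -> Q z = - Q (init (init z)).
Proof.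
move=> Q0 e; have Qi0 : Q (init z) = 0.
  case: n z Q0 e => [|p] z Q0 e.
    by rewrite /Q /= (ext_lastc (init z)) e /Phi addrN.
  by rewrite QE e /Phi addrCA subrr addr0 divfK // subrr.
rewrite QE Qi0 mulr0 sub0r; congr (- _).
by apply: eq_Qseq => k kn; rewrite -(ext_init (init z) kn).
Qed.

Lemma D_sub_dom n k (z : 'rV[R]_n) : D n k z -> Q z != 0.
Proof.
elim/ltn_ind: n k z => -[|[|n]] IH k z; first by rewrite oner_neq0.
- have e : z ord0 ord0 = lastc z by rewrite /lastc; congr (z _ _); exact: val_inj.
  rewrite /Q /= (ext_lastc z) -e /D /=.
  by case: k => [|[|k]] //= Dz; apply/eqP => h; lra.
have Qepi j : epi (@Phi n.+1) (D n.+1 j) z -> Q z != 0.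
  by move=> [/IH Q0 l]; apply: Q_step; [exact: Q0|rewrite gt_eqF].
have Qhypo j : hypo (@Phi n.+1) (D n.+1 j) z -> Q z != 0.
  by move=> [/IH Q0 l]; apply: Q_step; [exact: Q0|rewrite lt_eqF].
rewrite D_rec /Dstep; case: ifP => _; first exact: Qepi.
case: ifP => _; first exact: Qhypo.
case: ifP => // _ [[|[/IH Q0 l]]|]; [exact: Qhypo| |exact: Qepi].
by rewrite (Q_graph _ l) ?oppr_eq0; exact: Q0.
Qed.

End domains.

Arguments D {R} n k _.

(* Main.v *)
(* Put t = 2 + z + 1/z with 0 < z <= 1.  The solution of the three-term
   recurrence for (H - t) x = 0 is geometric beyond entry n, so t is an
   eigenvalue (a resonance, when z = 1 and t = 4) exactly when the Jost function
   Q_(n+1) - z Q_n, evaluated along the recurrence at t, vanishes.  Let s be the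
   number of sign changes in Q_0, ..., Q_n, Q_(n+1) - Q_n at t = 4.

   At least s eigenvalues lie above 4: as z goes from 0 to 1 the number of sign
   changes of the Sturm sequence goes from 0 to s, is constant where the Jost
   function does not vanish, and jumps by at most one where it does.  Not more
   than s: the ground-state substitution writes the form of 4 - H as a sum of
   squares with weights Q_k Q_(k+1), s of which are negative, plus a nonnegative
   tail, so H > 4 on no space of dimension s + 1.

   The spectral projection onto (4, oo) fixes the eigenvectors and kills their
   orthogonal complement by the same bound, so its trace is s.  If the Jost
   function does not vanish at z = 1, then s is locally constant in the
   potential; hence a virtual level forces it to vanish.  Finally D_k^(n) is the
   set where Q_n <> 0 and Q_0, ..., Q_n has k sign changes, and the graph
   condition is the vanishing of the Jost function. *)

Require Import Defs.
From mathcomp Require Import all_boot all_order all_algebra.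
From mathcomp Require Import complex.
From mathcomp Require Import all_classical all_reals all_analysis.
From mathcomp Require Import measurable_realfun ring lra zify.

Set Implicit Arguments.
Unset Strict Implicit.
Unset Printing Implicit Defensive.

Import Order.TTheory GRing.Theory Num.Theory.
Import numFieldNormedType.Exports.

Local Open Scope classical_set_scope.
Local Open Scope ring_scope.

(** * Sturm sequences *)

Section sign_changes.
Context {R : realType}.
Implicit Types q : nat -> R.

(* A zero entry counts as one sign change when it is left and none when it is
   entered: this is the right convention when the neighbours of every interior
   zero have opposite signs. *)
Definition sign_change (a b : R) : bool := (a == 0) || (a * b < 0).

Definition variations q (n : nat) : nat := \sum_(i < n) sign_change (q i) (q i.+1).

Lemma variationsS q n : variations q n.+1 = (variations q n + sign_change (q n) (q n.+1))%N.
Proof. by rewrite /variations big_ord_recr. Qed.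

Lemma variations_le q n : (variations q n <= n)%N.
Proof.
elim: n => [|n IH]; first by rewrite /variations big_ord0.
by rewrite variationsS -addn1 leq_add // leq_b1.
Qed.

Lemma eq_variations q q' n :
  (forall k, (k <= n)%N -> q k = q' k) -> variations q n = variations q' n.
Proof.
move=> e; apply: eq_bigr => i _.
by rewrite !e // ltnW // ltnS ltn_ord.
Qed.

(** The Sturm condition. Nothing is asked at the last entry, which may vanish; only there can sign
    changes be gained or lost under a perturbation. *)
Definition regular q (n : nat) : Prop :=
  q 0%N != 0 /\
  forall k, (k.+2 <= n)%N -> q k.+1 = 0 -> q k * q k.+2 < 0.

Lemma regular_le q m n : (m <= n)%N -> regular q n -> regular q m.
Proof. by move=> mn [q0 h]; split=> // k km; apply: h; exact: leq_trans mn. Qed.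

Lemma regularS q n : regular q n.+1 -> q n.+1 = 0 -> q n != 0.
Proof.
case: n => [|n] [q0 h] // e; apply/eqP => e'.
by have := h n (leqnn _) e'; rewrite e mulr0 ltxx.
Qed.

Lemma regular_variations2 q n : regular q n.+2 -> q n.+1 = 0 ->
  variations q n.+2 = (variations q n).+1.
Proof.
move=> h e; rewrite !variationsS e /sign_change eqxx (negbTE (regularS (regular_le _ h) e)) //.
by rewrite mulr0 ltxx addn0 addn1.
Qed.

(** Between two values of opposite signs the middle one has no influence on the count, whether it is
    positive, negative or zero. Hence the zero of an interior entry leaves the count unchanged. *)
Lemma sign_change_opp_ends (a b c : R) : a * c < 0 -> (sign_change a b + sign_change b c = 1)%N.
Proof.
move=> ac; rewrite /sign_change.
have a0 : a != 0 by apply: contraTneq ac => ->; rewrite mul0r ltxx.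
rewrite (negbTE a0) /=; have [->|b0] := eqVneq b 0; first by rewrite mulr0 ltxx.
have c0 : c != 0 by apply: contraTneq ac => ->; rewrite mulr0 ltxx.
have ab0 : a * b != 0 by rewrite mulf_neq0.
have b2 : 0 < b ^+ 2 by rewrite exprn_even_gt0.
have [ab|ab|ab] := ltgtP (a * b) 0; last by rewrite ab eqxx in ab0.
- suff -> : (b * c < 0) = false by [].
  by apply/negbTE; rewrite -leNgt; nra.
- suff -> : b * c < 0 by [].
  by nra.
Qed.

Section near.
Context {T : topologicalType} (p : T) (q : T -> nat -> R).

(** If the last two entries are nonzero at [p], their signs persist nearby and the induction drops
    one entry. If the last but one vanishes, its neighbours keep opposite signs nearby, so the last
    two steps contribute exactly one change, and the induction drops two entries. *)
Lemma variations_near_eq n : (forall k, (k <= n)%N -> {for p, continuous (q ^~ k)}) ->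
  regular (q p) n -> q p n != 0 ->
  \forall x \near p, variations (q x) n = variations (q p) n.
Proof.
elim/ltn_ind: n => -[|n] IH cq rq qn0.
  by apply: nearW => x; rewrite /variations !big_ord0.
have near_sign_change : q p n != 0 ->
    \forall x \near p, sign_change (q x n) (q x n.+1) = sign_change (q p n) (q p n.+1).
  move=> q0.
  have cn : {for p, continuous (q ^~ n)} by apply: cq; exact: leqnSn.
  have cm : (fun x => q x n * q x n.+1) @ p --> q p n * q p n.+1.
    by apply: cvgM => //; exact: (cq n.+1).
  have m0 : q p n * q p n.+1 != 0 by rewrite mulf_neq0.
  have nz : \forall x \near p, q x n != 0 by exact: cvgr_neq0 cn q0.
  rewrite /sign_change (negbTE q0) /=.
  have [l|l|e] := ltgtP (q p n * q p n.+1) 0; last by rewrite e eqxx in m0.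
  - have lt0 : \forall x \near p, q x n * q x n.+1 < 0 by exact: cvgr_lt cm _ l.
    by apply: filterS lt0 => x ->; rewrite orbT.
  - have gt0 : \forall x \near p, 0 < q x n * q x n.+1 by exact: cvgr_gt cm _ l.
    near=> x.
    have /negbTE -> : q x n != 0 by near: x.
    by apply/negbTE; rewrite /= -leNgt ltW //; near: x.
have [e|q0] := eqVneq (q p n) 0; last first.
  have IHn := IH n (leqnn _) (fun k h => cq k (leqW h)) (regular_le (leqnSn n) rq) q0.
  have nc := near_sign_change q0.
  near=> x; rewrite !variationsS; congr (_ + nat_of_bool _)%N.
    by near: x.
  by near: x.
case: n IH cq rq qn0 near_sign_change e => [|n] IH cq rq qn0 _ e.
  by case: rq; rewrite e eqxx.
have q0 := regularS (regular_le (leqnSn _) rq) e.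
have rqn : regular (q p) n by apply: regular_le rq; lia.
have IHn := IH n (ltnW (leqnn _)) (fun k h => cq k (leqW (leqW h))) rqn q0.
have cm : (fun x => q x n * q x n.+2) @ p --> q p n * q p n.+2.
  by apply: cvgM; [apply: (cq n); lia|exact: (cq n.+2)].
have l : q p n * q p n.+2 < 0 by case: rq => _; apply.
have lt0 : \forall x \near p, q x n * q x n.+2 < 0 by exact: cvgr_lt cm _ l.
near=> x.
rewrite (regular_variations2 rq e) !variationsS -addnA sign_change_opp_ends ?addn1; last by near: x.
by congr _.+1; near: x.
Unshelve. all: by end_near. Qed.

(** A last entry that vanishes at [p] counts nothing there, being entered and not left; nearby it
    may add one change but cannot remove any. *)
Lemma variations_near n : (forall k, (k <= n)%N -> {for p, continuous (q ^~ k)}) ->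
  regular (q p) n ->
  \forall x \near p, (variations (q p) n <= variations (q x) n <= (variations (q p) n).+1)%N.
Proof.
move=> cq rq.
have [e|q0] := eqVneq (q p n) 0; last first.
  by have := variations_near_eq cq rq q0; apply: filterS => x ->; rewrite leqnn leqnSn.
case: n cq rq e => [|n] cq rq e; first by case: rq; rewrite e eqxx.
have q0 := regularS rq e.
have := variations_near_eq (fun k h => cq k (leqW h)) (regular_le (leqnSn n) rq) q0.
apply: filterS => x ex; rewrite !variationsS ex e /sign_change (negbTE q0) mulr0 ltxx addn0.
by case: (_ || _) => /=; lia.
Qed.

End near.

(** The j-th zero is the infimum of the parameters with more than [j] sign changes. The count has
    values above [j] and at most [j] arbitrarily close to it, so the last entry must vanish
    there. *)
Lemma sturm (q : R -> nat -> R) n :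
  (forall k, (k <= n)%N -> continuous (q ^~ k)) ->
  (forall k, (k <= n)%N -> 0 < q 0 k) ->
  (forall z, 0 < z <= 1 -> regular (q z) n) ->
  exists f : nat -> R,
    (forall j, (j < variations (q 1%R) n)%N -> 0 < f j < 1 /\ q (f j) n = 0) /\
    (forall i j, (i < j)%N -> (j < variations (q 1%R) n)%N -> f i != f j).
Proof.
move=> cq q_pos rq.
have r0 : regular (q 0) n.
  split=> [|k kn e]; first by rewrite gt_eqF // q_pos.
  by have := q_pos _ (ltnW kn); rewrite e ltxx.
have {}rq z : 0 <= z <= 1 -> regular (q z) n.
  move=> /andP[]; rewrite le_eqVlt => /orP[/eqP <- //|z0 z1].
  by apply: rq; rewrite z0.
have var0 : variations (q 0) n = 0%N.
  apply: big1 => i _; rewrite /sign_change gt_eqF /=; last exact/q_pos/ltnW.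
  suff -> : (q 0 i * q 0 i.+1 < 0) = false by [].
  by apply/negbTE; rewrite -leNgt ltW // mulr_gt0 //; apply: q_pos => //; exact: ltnW.
pose S j := [set z : R | 0 <= z <= 1 /\ (j < variations (q z) n)%N].
pose f j := inf (S j).
have lbS j : lbound (S j) 0 by move=> z [/andP[]].
have hlbS j : has_lbound (S j) by exists 0; exact: lbS.
have S1 j : (j < variations (q 1%R) n)%N -> S j 1 by move=> h; split=> //; rewrite ler01 lexx.
have f01 j : (j < variations (q 1%R) n)%N -> 0 <= f j <= 1.
  move=> h; apply/andP; split; first by apply: lb_le_inf => //; exists 1; exact: S1.
  by apply: ge_inf => //; exact: S1.
have right j (e : R) : (j < variations (q 1%R) n)%N -> 0 < e ->
    exists2 w, `|f j - w| < e & S j w.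
  move=> h e0; have hi : has_inf (S j) by split=> //; exists 1; exact: S1.
  have [w Sw we] := inf_adherent e0 hi; exists w => //.
  by rewrite ltr_distlC; have := ge_inf (hlbS j) Sw; rewrite -/(f j) => ?; lra.
have left j (e : R) : 0 < f j -> (j < variations (q 1%R) n)%N -> 0 < e ->
    exists2 w, `|f j - w| < e & (variations (q w) n <= j)%N.
  move=> fj0 h e0; have /andP[_ f1] := f01 _ h.
  pose w := f j - Num.min (e / 2) (f j).
  have [me mf] : Num.min (e / 2) (f j) <= e / 2 /\ Num.min (e / 2) (f j) <= f j.
    by rewrite !ge_min !lexx orbT.
  (* The minimum with [f j] keeps [w] nonnegative; below the infimum, [w] cannot lie in [S j]. *)
  have m0 : 0 < Num.min (e / 2) (f j) by rewrite lt_min fj0 andbT; lra.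
  exists w; first by rewrite ltr_distlC /w; lra.
  rewrite leqNgt; apply/negP => wj.
  have : S j w by split=> //; rewrite /w; lra.
  by move/(ge_inf (hlbS j)); rewrite -/(f j) /w; lra.
have nbhsP (z : R) (P : R -> Prop) : (\forall x \near z, P x) ->
    exists2 e : R, 0 < e & forall x, `|z - x| < e -> P x.
  by move=> /nbhs_ballP[e e0 h]; exists e => // x xe; apply: h.
have f_gt0 j : (j < variations (q 1%R) n)%N -> 0 < f j.
  move=> h; have /andP[] := f01 _ h; rewrite le_eqVlt => /orP[/eqP e _|//].
  have q0n : q 0 n != 0 by rewrite gt_eqF // q_pos.
  have := variations_near_eq (fun k h => cq k h 0) r0 q0n.
  move=> /nbhsP[d d0 hd].
  have [w + [_]] := right j d h d0.
  by rewrite -e => /hd ->; rewrite var0.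
(* Even when the last entry vanishes at 1, the count just below 1 is not smaller than at 1, so [S j]
   contains a point below 1. *)
have f_lt1 j : (j < variations (q 1%R) n)%N -> f j < 1.
  move=> h; have r1 : regular (q 1) n by apply: rq; rewrite ler01 lexx.
  have /nbhsP[d d0 hd] := variations_near (fun k h => cq k h 1) r1.
  have [m1 m2] : Num.min (d / 2) 1 <= d / 2 /\ Num.min (d / 2) 1 <= 1.
    by rewrite !ge_min !lexx orbT.
  have m0 : 0 < Num.min (d / 2) 1 by rewrite lt_min ltr01 andbT; lra.
  pose w := 1 - Num.min (d / 2) 1.
  suff : S j w by move/(ge_inf (hlbS j)); rewrite -/(f j) /w; lra.
  split; first by rewrite /w; lra.
  have /andP[+ _] : (variations (q 1%R) n <= variations (q w) n <= (variations (q 1%R) n).+1)%N.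
    by apply: hd; rewrite ltr_distlC /w; lra.
  by apply: leq_trans.
exists f; split=> [j h|i j ij h].
  split; first by rewrite f_gt0 ?f_lt1.
  apply/eqP; apply/negPn/negP => qn0.
  have /nbhsP[d d0 hd] := variations_near_eq (fun k h => cq k h (f j)) (rq _ (f01 j h)) qn0.
  have [w wd [_]] := right j d h d0.
  have [w' w'd] := left j d (f_gt0 j h) h d0.
  by rewrite (hd _ wd) (hd _ w'd); lia.
(* Near a common infimum the count would take a value at most [i] and a value at least
   [j + 1 >= i + 2], whereas it varies there by at most one. *)
apply/negP => /eqP e.
have hi : (i < variations (q 1%R) n)%N by exact: ltn_trans h.
have /nbhsP[d d0 hd] := variations_near (fun k h => cq k h (f i)) (rq _ (f01 i hi)).
have [w wd [_]] := right j d h d0.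
have [w' w'd] := left i d (f_gt0 i hi) hi d0.
rewrite -e in wd; have := hd _ wd; have := hd _ w'd; lia.
Qed.

End sign_changes.

(** * The Jost function as the end of a Sturm sequence *)

Section jost.
Context {R : realType}.
Implicit Types m : nat -> R.

(* [jost_poly m z k / z ^+ k] is, up to the sign (-1)^k and the normalization of entry
   0, the solution of (H - t) x = 0 with t = 2 + z + z^-1. *)
Fixpoint jost_poly m (z : R) (k : nat) : R :=
  match k with
  | 0 => 1
  | 1 => (1 + z ^+ 2) / 2 - m 0%N * z
  | ((j.+1) as i).+1 => (1 + z ^+ 2 - m i * z) * jost_poly m z i - z ^+ 2 * jost_poly m z j
  end.

Lemma jost_poly1 m z : jost_poly m z 1 = (1 + z ^+ 2) / 2 - m 0%N * z.
Proof. by []. Qed.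

Lemma jost_polySS m z k :
  jost_poly m z k.+2 = (1 + z ^+ 2 - m k.+1 * z) * jost_poly m z k.+1 - z ^+ 2 * jost_poly m z k.
Proof. by []. Qed.
Arguments jost_poly : simpl never.

Lemma jost_poly_nz m z k : z != 0 -> jost_poly m z k.+1 = 0 -> jost_poly m z k != 0.
Proof.
move=> z0; elim: k => [|k IH] e; first exact: oner_neq0.
apply/eqP => e'; have := IH e'; move: e; rewrite jost_polySS e' mulr0 sub0r.
by move/eqP; rewrite oppr_eq0 mulf_eq0 expf_eq0 /= (negbTE z0) => /= /eqP ->; rewrite eqxx.
Qed.

Lemma jost_poly0_gt0 m k : 0 < jost_poly m 0 k.
Proof.
elim/ltn_ind: k => -[|[|k]] IH; [exact: ltr01| |].
- by rewrite jost_poly1 expr0n /=; lra.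
- by rewrite jost_polySS expr0n /= mulr0 mul0r !subr0 addr0 mul1r IH.
Qed.

(** The recurrence for [jost_poly] subtracts the potential where that for [Qseq] adds it: this is
    why the graph condition concerns [- mu]. *)
Lemma jost_poly_Qseq m m' k : (forall i, (i < k)%N -> m' i = - m i) -> jost_poly m 1 k = Qseq m' k.
Proof.
elim/ltn_ind: k => -[|[|k]] IH mm' //.
- by rewrite jost_poly1 /= mm' //; field.
- have e1 : jost_poly m 1 k.+1 = Qseq m' k.+1.
    by apply: IH => // i ik; apply: mm'; exact: ltnW.
  have e0 : jost_poly m 1 k = Qseq m' k.
    by apply: IH => [|i ik]; [exact: ltnW|apply: mm'; rewrite ltnW // ltnW].
  by rewrite jost_polySS QseqSS mm' // e1 e0; ring.
Qed.

(* The last entry is z^(n+1) times the Jost function, which vanishes at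
   z in (0, 1) iff 2 + z + z^-1 is an eigenvalue and at 1 iff 4 is a
   resonance. *)
Definition jost n m z (k : nat) : R :=
  if k == n.+1 then jost_poly m z n.+1 - z ^+ 2 * jost_poly m z n else jost_poly m z k.

Lemma jostE n m z k : (k <= n)%N -> jost n m z k = jost_poly m z k.
Proof. by rewrite /jost => kn; rewrite ltn_eqF. Qed.

Lemma jost_last n m z : jost n m z n.+1 = jost_poly m z n.+1 - z ^+ 2 * jost_poly m z n.
Proof. by rewrite /jost eqxx. Qed.

Lemma jost_regular n m z : z != 0 -> regular (jost n m z) n.+1.
Proof.
move=> z0; split; first by rewrite jostE // oner_neq0.
move=> k kn; have kn' : (k.+1 <= n)%N by [].
rewrite (jostE _ _ kn') (jostE _ _ (ltnW kn')) => e.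
(* At a zero the recurrence leaves only [- z ^+ 2] times the entry before. The last entry is no
   exception: the term subtracted in it is a multiple of the entry that vanishes. *)
have -> : jost n m z k.+2 = - z ^+ 2 * jost_poly m z k.
  move: kn; rewrite ltnS leq_eqVlt => /orP[/eqP <-|kn].
    by rewrite jost_last jost_polySS e !mulr0 subr0 sub0r mulNr.
  by rewrite jostE // jost_polySS e mulr0 sub0r mulNr.
have := jost_poly_nz z0 e => u0.
have u2 : 0 < jost_poly m z k ^+ 2 by rewrite exprn_even_gt0.
have z2 : 0 < z ^+ 2 by rewrite exprn_even_gt0.
by have := mulr_gt0 u2 z2; lra.
Qed.

Lemma jost_poly_continuous m k : continuous (jost_poly m ^~ k).
Proof.
elim/ltn_ind: k => -[|[|k]] IH x.
- exact: cvg_cst.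
- apply: cvgB; last by apply: cvgM; [exact: cvg_cst|exact: cvg_id].
  by apply: cvgM; [apply: cvgD; [exact: cvg_cst|exact: exprn_continuous]|exact: cvg_cst].
have c0 := IH k (leqnSn _) x; have c1 := IH k.+1 (leqnn _) x.
have c2 : {for x, continuous (fun z : R => z ^+ 2)} by exact: exprn_continuous.
have c3 : {for x, continuous (fun z : R => 1 + z ^+ 2 - m k.+1 * z)}.
  apply: cvgB; first by apply: cvgD; [exact: cvg_cst|exact: c2].
  by apply: cvgM; [exact: cvg_cst|exact: cvg_id].
exact: (cvgB (cvgM c3 c1) (cvgM c2 c0)).
Qed.

Lemma jost_continuous n m k : continuous (jost n m ^~ k).
Proof.
rewrite /jost; case: eqP => _ x; last exact: jost_poly_continuous.
apply: cvgB; first exact: jost_poly_continuous.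
by apply: cvgM; [exact: exprn_continuous|exact: jost_poly_continuous].
Qed.

Lemma jost_poly_continuous_potential (T : topologicalType) (m : T -> nat -> R) (p : T) z k :
  (forall i, {for p, continuous (m ^~ i)}) ->
  {for p, continuous (fun x => jost_poly (m x) z k)}.
Proof.
move=> cm; elim/ltn_ind: k => -[|[|k]] IH.
- exact: cvg_cst.
- apply: cvgB; first exact: cvg_cst.
  by apply: cvgM; [exact: cm|exact: cvg_cst].
have c0 := IH k (leqnSn _); have c1 := IH k.+1 (leqnn _).
have c2 : {for p, continuous (fun=> z ^+ 2)} by exact: cvg_cst.
have c3 : {for p, continuous (fun x => 1 + z ^+ 2 - m x k.+1 * z)}.
  apply: cvgB; first exact: cvg_cst.
  by apply: cvgM; [exact: cm|exact: cvg_cst].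
exact: (cvgB (cvgM c3 c1) (cvgM c2 c0)).
Qed.

Lemma jost_continuous_potential (T : topologicalType) (m : T -> nat -> R)
    (p : T) n z k :
  (forall i, {for p, continuous (m ^~ i)}) ->
  {for p, continuous (fun x => jost n (m x) z k)}.
Proof.
move=> cm; rewrite /jost; case: eqP => _; last exact: jost_poly_continuous_potential.
apply: cvgB; first exact: jost_poly_continuous_potential.
by apply: cvgM; [exact: cvg_cst|exact: jost_poly_continuous_potential].
Qed.

Lemma jost_zeros n m : exists f : nat -> R,
  (forall j, (j < variations (jost n m 1) n.+1)%N ->
     0 < f j < 1 /\ jost_poly m (f j) n.+1 = f j ^+ 2 * jost_poly m (f j) n) /\
  (forall i j, (i < j)%N -> (j < variations (jost n m 1) n.+1)%N -> f i != f j).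
Proof.
have [f [fz fi]] : exists f : nat -> R,
    (forall j, (j < variations (jost n m 1) n.+1)%N ->
       0 < f j < 1 /\ jost n m (f j) n.+1 = 0) /\
    (forall i j, (i < j)%N -> (j < variations (jost n m 1) n.+1)%N -> f i != f j).
  apply: sturm => [k _|k _|z /andP[z0 _]].
  - exact: jost_continuous.
  - rewrite /jost; case: eqP => _; last exact: jost_poly0_gt0.
    by rewrite expr0n mul0r subr0 jost_poly0_gt0.
  - by apply: jost_regular; rewrite gt_eqF.
exists f; split=> // j /fz[f01 /eqP]; rewrite jost_last subr_eq0 => /eqP.
by split.
Qed.

(** Beyond entry [n] the recurrence has the characteristic roots 1 and z^2; a vanishing Jost
    function selects z^2, so that [jost_poly m z k / z ^+ k] behaves like z^k. *)
Lemma jost_poly_tail n m z j : (forall k, (n < k)%N -> m k = 0) ->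
  jost_poly m z n.+1 = z ^+ 2 * jost_poly m z n ->
  jost_poly m z (n + j) = (z ^+ 2) ^+ j * jost_poly m z n.
Proof.
move=> m0 e.
have step k : jost_poly m z (n + k).+1 = z ^+ 2 * jost_poly m z (n + k).
  elim: k => [|k IH]; first by rewrite addn0.
  by rewrite addnS jost_polySS m0 ?IH ?ltnS ?leq_addr //; ring.
elim: j => [|j IH]; first by rewrite addn0 expr0 mul1r.
by rewrite addnS step IH [_ ^+ j.+1]exprS mulrA.
Qed.

End jost.

(** * The domains D_k^(n) *)

Section domains.
Context {R : realType}.

Lemma sign_change_pos (a b : R) : a != 0 -> sign_change a b = (a * b < 0).
Proof. by rewrite /sign_change => /negbTE ->. Qed.

Lemma Qseq_nz (m : nat -> R) n : Qseq m n.+1 = 0 -> Qseq m n != 0.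
Proof.
elim: n => [|n IH] e; first exact: oner_neq0.
apply/eqP => e'; have := IH e'; move: e; rewrite QseqSS e' mulr0 sub0r => /eqP.
by rewrite oppr_eq0 => /eqP ->; rewrite eqxx.
Qed.

(** The difference [lastc z - Phi (init z)] is Q_(n+1) Q_(n+2) / Q_(n+1)^2, so hypograph and
    epigraph are told apart by the sign of the product. *)
Lemma Phi_chg n (z : 'rV[R]_n.+2) : Qseq (ext z) n.+1 != 0 ->
  (lastc z < Phi (init z)) = (Qseq (ext z) n.+1 * Qseq (ext z) n.+2 < 0) /\
  (Phi (init z) < lastc z) =
    (Q z != 0) && ~~ (Qseq (ext z) n.+1 * Qseq (ext z) n.+2 < 0).
Proof.
move=> q0.
have eQ k : (k <= n.+1)%N -> Qseq (ext (init z)) k = Qseq (ext z) k.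
  by move=> kn; apply: eq_Qseq => i ik; rewrite ext_init // (leq_trans ik).
rewrite /Phi /Q !eQ // QseqSS ext_lastc.
set a := Qseq _ n.+1; set b := Qseq _ n; set l := lastc z.
have a0 : a != 0 by [].
have a2 : 0 < a ^+ 2 by rewrite exprn_even_gt0.
have key : l - (b / a - 2) = (a ^+ 2)^-1 * (a * ((2 + l) * a - b)) by field.
split; first by rewrite -subr_lt0 key pmulr_rlt0 // invr_gt0.
rewrite -subr_gt0 key -leNgt le_eqVlt.
rewrite pmulr_rgt0 ?invr_gt0 // [0 == _]eq_sym [a * _ == 0]mulf_eq0 (negbTE a0) /=.
by case: eqP => [->|//]; rewrite mulr0 ltxx.
Qed.

(** Induction along the definition of the domains: the hypograph adds a sign change, the epigraph
    adds none, and the graph piece, where Q_(n+1) = 0, passes through a zero and so adds one to the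
    count at [n]. *)
Lemma DP n k (z : 'rV[R]_n) : D n k z <-> Q z != 0 /\ variations (Qseq (ext z)) n = k.
Proof.
elim/ltn_ind: n k z => -[|[|n]] IH k z.
- rewrite /Q /variations big_ord0 oner_neq0 /D /= /D0.
  by case: k => [|k]; split=> //= -[].
- have e : z ord0 ord0 = ext z 0.
    by rewrite ext_lastc /lastc; congr (z _ _); exact: val_inj.
  rewrite /Q variationsS /variations big_ord0 add0n sign_change_pos ?oner_neq0 //= mul1r.
  have e1 : (- 1 < z ord0 ord0) = (0 < 1 + ext z 0).
    by rewrite e addrC -subr_gt0 opprK.
  have e2 : (z ord0 ord0 < - 1) = (1 + ext z 0 < 0).
    by rewrite e addrC -subr_lt0 opprK.
  by have [l|l|l] := ltgtP (1 + ext z 0) 0; case: k => [|[|k]] /=;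
    rewrite /D /= ?e1 ?e2 ?(lt_gtF l) ?l ?ltxx; split=> // -[].
have IHn j := IH n (leqW (leqnn _)) j (init (init z)).
have IHn1 j := IH n.+1 (leqnn _) j (init z).
have eQ1 k' : (k' <= n.+1)%N -> Qseq (ext (init z)) k' = Qseq (ext z) k'.
  by move=> kn; apply: eq_Qseq => i ik; rewrite ext_init // (leq_trans ik).
have eQ k' : (k' <= n)%N -> Qseq (ext (init (init z))) k' = Qseq (ext z) k'.
  move=> kn; rewrite -eQ1 ?leqW //.
  by apply: eq_Qseq => i ik; rewrite ext_init // (leq_trans ik).
have Q1 : Q (init z) = Qseq (ext z) n.+1 by rewrite /Q eQ1.
have Q0 : Q (init (init z)) = Qseq (ext z) n by rewrite /Q eQ.
have v1 : variations (Qseq (ext (init z))) n.+1 = variations (Qseq (ext z)) n.+1.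
  by apply: eq_variations => i; exact: eQ1.
have v0 : variations (Qseq (ext (init (init z)))) n = variations (Qseq (ext z)) n.
  by apply: eq_variations => i; exact: eQ.
have le1 := variations_le (Qseq (ext z)) n.+1; have le0 := variations_le (Qseq (ext z)) n.
(* The three cases of [Dstep] become one: the pieces missing for the extreme values of [k] are
   empty, since a count never exceeds the number of steps. *)
have stepP : D n.+2 k z <->
    [\/ (exists2 j, k = j.+1 & hypo (@Phi R n.+1) (D n.+1 j) z),
        (exists2 j, k = j.+1 & graph (@Phi R n) (D n j) (init z))
      | epi (@Phi R n.+1) (D n.+1 k) z].
  rewrite D_rec /Dstep; case: k => [|k] /=.
    by split=> [|[[]|[]|]] //; constructor 3.
  rewrite eqSS; case: eqP => [->|kn].
    split=> [h|[[j [<-]]|[j [<-]] [/IHn[_]]|[/IHn1[_]]]] //.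
    - by constructor 1; exists n.+1.
    - by rewrite v0 => ?; lia.
    - by rewrite v1 => ?; lia.
  case: ltnP => kn'.
    split=> [[[h|h]|h]|[[j [<-]] h|[j [<-]] h|h]].
    - by constructor 1; exists k.
    - by constructor 2; exists k.
    - by constructor 3.
    - by left; left.
    - by left; right.
    - by right.
  split=> // -[[j [<-]] [/IHn1[_]]|[j [<-]] [/IHn[_]]|[/IHn1[_]]]; rewrite ?v0 ?v1; lia.
rewrite stepP; have [q0|q1] := eqVneq (Qseq (ext z) n.+1) 0.
- have qn := Qseq_nz q0.
  have reg : Q z = - Qseq (ext z) n.
    by rewrite /Q QseqSS q0 mulr0 sub0r.
  have vz : variations (Qseq (ext z)) n.+2 = (variations (Qseq (ext z)) n).+1.
    by rewrite !variationsS (sign_change_pos _ qn) q0 mulr0 ltxx /sign_change eqxx /=; lia.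
  (* Q_(n+1) = 0 is solved for its last coordinate; for [n = 0] this gives the convention that Phi_0
     is -1. *)
  have gr : lastc (init z) = Phi (init (init z)).
    case: n {IH IHn IHn1 eQ1 eQ Q1 Q0 v1 v0 le1 le0 stepP reg vz} z q0 qn => [|n] z.
      by rewrite /Phi /= -ext_lastc ext_init // => e _; lra.
    move=> q0 qn; rewrite -ext_lastc ext_init // /Phi /Q.
    have eQ k' : (k' <= n.+1)%N -> Qseq (ext (init (init z))) k' = Qseq (ext z) k'.
      by move=> kn; apply: eq_Qseq => i ik; rewrite !ext_init //; lia.
    rewrite !eQ //; move: q0; rewrite QseqSS => q0.
    apply/(mulIf qn); rewrite mulrBl divfK //.
    by move: q0; set a := Qseq _ n.+1; set b := Qseq _ n => ?; lra.
  rewrite reg oppr_eq0 vz; split.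
  + case=> [[j _ [/IHn1[]]]|[j -> [/IHn[_ <-] _]]|[/IHn1[]]].
    * by rewrite Q1 q0 eqxx.
    * by rewrite v0.
    * by rewrite Q1 q0 eqxx.
  + move=> [_ <-]; constructor 2; eexists; first by [].
    by split=> //; apply/IHn; rewrite Q0 v0.
- have [hyE epE] := Phi_chg q1.
  rewrite variationsS (sign_change_pos _ q1); split.
  + case=> [[j -> [/IHn1[_ <-]]]|[j _ [/IHn[qn _] gr]]|[/IHn1[_ <-]]].
    * rewrite hyE v1 => l; rewrite l addn1; split=> //.
      by apply: contraTneq l; rewrite /Q => ->; rewrite mulr0 ltxx.
    (* On the graph Q_(n+1) would vanish. *)
    * exfalso; move: q1; rewrite -Q1.
      case: n z {IH IHn IHn1 eQ1 eQ Q1 Q0 v1 v0 le1 le0 stepP hyE epE} qn gr => [|n] z qn gr.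
        by rewrite /Q /= ext_lastc gr /Phi addrN eqxx.
      by rewrite QE gr /Phi addrCA subrr addr0 divfK // subrr eqxx.
    * by rewrite epE v1 => /andP[-> /negbTE ->]; rewrite addn0.
  + move=> [Qz <-]; case l : (_ * _ < 0).
      constructor 1; exists (variations (Qseq (ext z)) n.+1); first by rewrite addn1.
      by split; [apply/IHn1; rewrite Q1 v1|rewrite hyE].
    constructor 3; split; last by rewrite epE Qz l.
    by apply/IHn1; rewrite Q1 v1 addn0.
Qed.

End domains.

(** * The quadratic form at the threshold *)

Section squares.
Context {R : realType}.
Implicit Types d q y : nat -> R.

(** The value 0 stands for q_(-1), so that the recurrence starts at index 0. *)
Definition preceding q (k : nat) : R := if k is j.+1 then q j else 0.

Definition step_form q y (k : nat) : R :=
  if q k == 0 then y k else q k.+1 * y k - q k * y k.+1.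

(* With no zero among the q k, the form is
   \sum_(k < l) q_k q_(k+1) (y_k / q_k - y_(k+1) / q_(k+1)) ^ 2; a vanishing
   q_(k+1) merges two steps, which are then killed by y_(k+1) = 0. *)
Lemma sum_squares_ge0 d q y n l :
  q 0%N = 1 -> (forall k, (k < n)%N -> q k.+1 = d k * q k - preceding q k) ->
  (forall k, (k < n)%N -> sign_change (q k) (q k.+1) -> step_form q y k = 0) ->
  (l <= n)%N -> q l != 0 ->
  0 <= \sum_(k < l) (d k * y k ^+ 2 - 2 * (y k * y k.+1)) + preceding q l / q l * y l ^+ 2.
Proof.
move=> q0 rec van; elim/ltn_ind: l => -[|l] IH ln ql.
  by rewrite big_ord0 /= !mul0r addr0.
rewrite big_ord_recr /=; have [e|qn0] := eqVneq (q l) 0.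
  case: l e IH ln ql => [|l] e IH ln ql; first by move: e; rewrite q0 => /eqP; rewrite oner_eq0.
  have yl : y l.+1 = 0.
    by have := van _ ln; rewrite /sign_change /step_form e eqxx /= => /(_ isT).
  have ql0 : q l != 0.
    by move: ql; rewrite rec // e mulr0 sub0r oppr_eq0.
  (* Since the next entry vanishes, the summand [d l * y l ^+ 2] is precisely the boundary term of
     the induction hypothesis two steps back. *)
  have dl : d l = preceding q l / q l.
    apply: (mulIf ql0); rewrite divfK //; apply/eqP.
    by rewrite -subr_eq0 -rec ?e // ltnW.
  have := IH l (leqW (leqnn _)) (leq_trans (leqW (leqnSn l)) ln) ql0.
  rewrite big_ord_recr /= yl e dl !(mul0r, mulr0, expr0n) /=.
  by rewrite !(subr0, addr0, mul0r, mulr0).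
have := IH l (leqnn _) (ltnW ln) qn0.
set S := \sum_(_ < _) _; set P := preceding q l => S0.
have rl : q l.+1 = d l * q l - P by rewrite rec.
(* Completing the square: the old boundary term is exchanged for the new one and a square with
   weight 1 / (q_l q_(l+1)), which is negative only at a sign change, where [van] kills it. *)
have key : S + (d l * y l ^+ 2 - 2 * (y l * y l.+1)) + q l / q l.+1 * y l.+1 ^+ 2
   = S + P / q l * y l ^+ 2 +
     (q l * q l.+1)^-1 * (q l.+1 * y l - q l * y l.+1) ^+ 2.
  have -> : d l = (q l.+1 + P) / q l by rewrite rl; field.
  by field; rewrite ql qn0.
rewrite key addr_ge0 //.
have [c|c] := boolP (sign_change (q l) (q l.+1)).
  have := van _ ln c; rewrite /step_form (negbTE qn0) => ->.
  by rewrite expr0n mulr0.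
rewrite mulr_ge0 ?sqr_ge0 // invr_ge0.
by move: c; rewrite /sign_change negb_or -leNgt => /andP[].
Qed.

(** The boundary term at [n.+1] disappears with [y n.+1]. If [q n.+1 = 0], the sum is cut one step
    earlier and its last summand is the boundary term at [n]. *)
Lemma sum_squares_last d q y n :
  q 0%N = 1 -> (forall k, (k <= n)%N -> q k.+1 = d k * q k - preceding q k) ->
  (forall k, (k <= n)%N -> sign_change (q k) (q k.+1) -> step_form q y k = 0) ->
  (q n.+1 = 0 -> q n != 0) -> y n.+1 = 0 ->
  0 <= \sum_(k < n.+1) (d k * y k ^+ 2 - 2 * (y k * y k.+1)).
Proof.
move=> q0 rec van nz yn.
have [e|qn] := eqVneq (q n.+1) 0; last first.
  have := sum_squares_ge0 (n := n.+1) q0 rec van (leqnn _) qn.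
  by rewrite yn expr0n mulr0 addr0.
have qn := nz e.
have := sum_squares_ge0 (n := n.+1) q0 rec van (leqnSn _) qn.
have dl : d n = preceding q n / q n.
  apply: (mulIf qn); rewrite divfK //; apply/eqP.
  by rewrite -subr_eq0 -rec ?e.
by rewrite big_ord_recr /= yn !mulr0 subr0 dl.
Qed.

(** These are s homogeneous equations in s + 1 unknowns: the left kernel of the matrix [M] is
    nonzero by rank. *)
Lemma common_zero (n s : nat) (bad : pred 'I_n) (G : 'I_s.+1 -> 'I_n -> R) :
  #|bad| = s ->
  exists2 c : 'I_s.+1 -> R, exists i, c i != 0 &
    forall k, bad k -> \sum_i c i * G i k = 0.
Proof.
move=> bs; pose M := \matrix_(i < s.+1, j < #|bad|) G i (enum_val j).
have : kermx M != 0.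
  rewrite kermx_eq0; apply/negP => /eqP rM.
  by have := rank_leq_col M; rewrite rM bs ltnn.
move/rowV0Pn => [c /sub_kermxP cM c0].
exists (c ord0).
  move: c0 => /rV0Pn[i ci]; by exists i.
move=> k bk; have kb : k \in bad by [].
move/matrixP: cM => /(_ ord0 (enum_rank_in kb k)); rewrite mxE [RHS]mxE => e.
rewrite -[RHS]e; by apply: eq_bigr => i _; rewrite mxE enum_rankK_in.
Qed.

End squares.

(** * Real square-summable sequences *)

Section real_l2.
Context {R : realType}.
Implicit Types x y z : nat -> R.

Definition rl2 x : Prop := cvgn (series (fun k => x k ^+ 2)).

Definition rdot x y : R := limn (series (fun k => x k * y k)).

Lemma rl2_le x y (M : R) : (forall k, `|x k| <= M * `|y k|) -> rl2 y -> rl2 x.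
Proof.
move=> xy l2y.
apply: (@series_le_cvg _ _ (fun k => M ^+ 2 * y k ^+ 2)) => [k|k|k|].
- exact: sqr_ge0.
- by rewrite mulr_ge0 ?sqr_ge0.
- rewrite -[x k ^+ 2]real_normK ?num_real // -[y k ^+ 2]real_normK ?num_real //.
  by rewrite -exprMn ler_sqr ?nnegrE // (le_trans _ (xy k)).
- exact: (is_cvg_seriesZ l2y).
Qed.

Lemma rl2Z c x : rl2 x -> rl2 (fun k => c * x k).
Proof. by apply: (@rl2_le _ _ `|c|) => k; rewrite normrM. Qed.

Lemma rl2D x y : rl2 x -> rl2 y -> rl2 (fun k => x k + y k).
Proof.
move=> hx hy; apply: (@series_le_cvg _ _ (fun k => 2 * (x k ^+ 2 + y k ^+ 2))) => [k|k|k|].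
- exact: sqr_ge0.
- by rewrite mulr_ge0 ?addr_ge0 ?sqr_ge0.
- by have := sqr_ge0 (x k - y k); lra.
- exact: (is_cvg_seriesZ (is_cvg_seriesD hx hy)).
Qed.

Lemma rl2_0 : rl2 (fun=> 0).
Proof.
rewrite /rl2 (_ : series _ = fun=> 0); first exact: is_cvg_cst.
by apply/funext => n; rewrite /series /= big1 // => i _; rewrite expr0n.
Qed.

Lemma rl2_sum (I : Type) (s : seq I) (x : I -> nat -> R) : (forall i, rl2 (x i)) ->
  rl2 (fun k => \sum_(i <- s) x i k).
Proof.
move=> h; elim: s => [|i s IH].
  rewrite (_ : (fun _ => _) = fun=> 0); first exact: rl2_0.
  by apply/funext => k; rewrite big_nil.
rewrite (_ : (fun _ => _) = fun k => x i k + \sum_(j <- s) x j k); first exact: rl2D.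
by apply/funext => k; rewrite big_cons.
Qed.

Lemma rl2_shift x : rl2 x -> rl2 (fun k => x k.+1).
Proof.
rewrite /rl2 => h.
rewrite (_ : series _ = fun n => series (fun k => x k ^+ 2) n.+1 - x 0%N ^+ 2).
  apply: is_cvgB; last exact: is_cvg_cst.
  by move/cvg_ex: h => [l hl]; apply/cvg_ex; exists l; rewrite cvg_shiftS.
apply/funext => n; rewrite /series /= big_nat_recl //=.
by rewrite addrAC subrr add0r.
Qed.

Lemma rl2_unshift x : rl2 x -> rl2 (preceding x).
Proof.
rewrite /rl2 => /cvg_ex[l hl]; apply/cvg_ex; exists l.
rewrite -cvg_shiftS (_ : (fun n => _) = series (fun k => x k ^+ 2)) //.
by apply/funext => n; rewrite /series /= big_nat_recl //= expr0n add0r.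
Qed.

Lemma rdot_cvg x y : rl2 x -> rl2 y -> cvgn (series (fun k => x k * y k)).
Proof.
move=> hx hy; apply: normed_cvg.
apply: (@series_le_cvg _ _ (fun k => x k ^+ 2 + y k ^+ 2)) => [k|k|k|].
- exact: normr_ge0.
- by rewrite addr_ge0 ?sqr_ge0.
- rewrite /= normrM -(real_normK (num_real (x k))) -(real_normK (num_real (y k))).
  have := sqr_ge0 (`|x k| - `|y k|).
  by have := sqr_ge0 (`|x k|); have := sqr_ge0 (`|y k|); nra.
- exact: is_cvg_seriesD.
Qed.

Lemma rdotC x y : rdot x y = rdot y x.
Proof.
by congr (limn (series _)); apply/funext => k; rewrite mulrC.
Qed.

Lemma rdotDr x y z : rl2 x -> rl2 y -> rl2 z ->
  rdot x (fun k => y k + z k) = rdot x y + rdot x z.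
Proof.
move=> hx hy hz; rewrite /rdot -lim_seriesD; try exact: rdot_cvg.
by congr (limn (series _)); apply/funext => k; rewrite mulrDr.
Qed.

Lemma rdotZr c x y : rl2 x -> rl2 y -> rdot x (fun k => c * y k) = c * rdot x y.
Proof.
move=> hx hy; rewrite /rdot -[RHS](lim_seriesZ (V := R)); last exact: rdot_cvg.
by congr (limn (series _)); apply/funext => k; rewrite mulrCA.
Qed.

Lemma rdot0r x : rdot x (fun=> 0) = 0.
Proof.
rewrite /rdot (_ : series _ = fun=> 0) ?lim_cst //.
by apply/funext => n; rewrite /series /= big1 // => i _; rewrite mulr0.
Qed.

Lemma rdot_ge0 x : rl2 x -> 0 <= rdot x x.
Proof.
move=> hx; have := rdot_cvg hx hx; rewrite /rdot => h.
apply: limr_ge => //; apply: nearW => n.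
by rewrite /series /= sumr_ge0 // => i _; rewrite -expr2 sqr_ge0.
Qed.

Lemma rdot_gt0 x k : rl2 x -> x k != 0 -> 0 < rdot x x.
Proof.
move=> hx xk; have h := rdot_cvg hx hx.
have xk2 : 0 < x k * x k by rewrite -expr2 exprn_even_gt0.
apply: lt_le_trans xk2 _; rewrite /rdot; apply: limr_ge => //.
near=> n; rewrite /series /= big_mkord.
have kn : (k < n)%N by near: n; exact: nbhs_infty_gt.
rewrite (bigD1 (Ordinal kn)) //= lerDl sumr_ge0 // => i _.
by rewrite -expr2 sqr_ge0.
Unshelve. all: by end_near. Qed.

Lemma rdot_sumr (I : Type) (s : seq I) x (y : I -> nat -> R) :
  rl2 x -> (forall i, rl2 (y i)) ->
  rdot x (fun k => \sum_(i <- s) y i k) = \sum_(i <- s) rdot x (y i).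
Proof.
move=> hx hy; elim: s => [|i s IH].
  rewrite big_nil (_ : (fun _ => _) = fun=> 0) ?rdot0r //.
  by apply/funext => k; rewrite big_nil.
rewrite big_cons -IH -rdotDr //; last exact: rl2_sum.
by congr rdot; apply/funext => k; rewrite big_cons.
Qed.

Section jacobi.
Variables (a b : nat -> R) (M : R).
Hypotheses (aM : forall k, `|a k| <= M) (bM : forall k, `|b k| <= M).

Definition rjac x (k : nat) : R :=
  (if k is j.+1 then a j * x j else 0) + b k * x k + a k * x k.+1.

Lemma rl2_bounded_mul (c : nat -> R) x : (forall k, `|c k| <= M) ->
  rl2 x -> rl2 (fun k => c k * x k).
Proof. by move=> cM; apply: (@rl2_le _ _ M) => k; rewrite normrM ler_wpM2r. Qed.

Lemma rl2_rjac x : rl2 x -> rl2 (rjac x).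
Proof.
move=> hx; apply: rl2D; last by apply: rl2_bounded_mul => //; exact: rl2_shift.
apply: rl2D; last exact: rl2_bounded_mul.
rewrite (_ : (fun _ => _) = preceding (fun k => a k * x k)); last by apply/funext => -[].
by apply: rl2_unshift; exact: rl2_bounded_mul.
Qed.

Lemma rjacD x y : rjac (fun k => x k + y k) = (fun k => rjac x k + rjac y k).
Proof. by apply/funext => -[|k]; rewrite /rjac; ring. Qed.

Lemma rjacZ c x : rjac (fun k => c * x k) = (fun k => c * rjac x k).
Proof. by apply/funext => -[|k]; rewrite /rjac; ring. Qed.

Lemma rjac_sum (I : Type) (s : seq I) (x : I -> nat -> R) :
  rjac (fun k => \sum_(i <- s) x i k) = (fun k => \sum_(i <- s) rjac (x i) k).
Proof.
elim: s => [|i s IH].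
  by apply/funext => -[|k]; rewrite /rjac !big_nil; ring.
rewrite (_ : (fun _ => _) = fun k => x i k + \sum_(j <- s) x j k).
  by rewrite rjacD IH; apply/funext => k; rewrite big_cons.
by apply/funext => k; rewrite big_cons.
Qed.

(** Summation by parts: the partial sums of the difference telescope to the discrete Wronskian [w],
    which tends to 0 on square-summable sequences. *)
Lemma rjac_sym x y : rl2 x -> rl2 y -> rdot x (rjac y) = rdot (rjac x) y.
Proof.
move=> hx hy; apply/eqP; rewrite -subr_eq0 (rdotC (rjac x)) /rdot.
have c1 := rdot_cvg hx (rl2_rjac hy); have c2 := rdot_cvg hy (rl2_rjac hx).
rewrite -lim_seriesB //; apply/eqP.
pose w n := (a n * x n) * y n.+1 - (a n * y n) * x n.+1.
have w0 : w @ \oo --> 0.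
  rewrite -[0 : R]subr0; apply: cvgB; apply: cvg_series_cvg_0; apply: rdot_cvg;
    try exact: rl2_shift; exact: rl2_bounded_mul.
apply: cvg_lim => //; rewrite -cvg_shiftS.
rewrite (_ : (fun n => _) = w) //; apply/funext => n.
rewrite /series /=; elim: n => [|n IH].
  by rewrite big_nat1 /w /= !fctE /rjac; ring.
by rewrite big_nat_recr //= IH /w !fctE /rjac; ring.
Qed.

End jacobi.
End real_l2.

(** * Directions in which H exceeds 4 *)

Section threshold_form.
Context {R : realType}.
Implicit Types (m x y z : nat -> R).

Definition diag m (k : nat) : R := 2 + (if k == 0%N then 2 * m 0%N else m k).

Definition rH m := rjac (@free_offdiag R) (diag m).

Lemma sqrt2_sq : Num.sqrt 2 ^+ 2 = 2 :> R.
Proof. by rewrite sqr_sqrtr. Qed.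

Lemma rH_bounded n m : (forall k, (n < k)%N -> m k = 0) ->
  exists M : R, (forall k, `|free_offdiag k| <= M) /\ (forall k, `|diag m k| <= M).
Proof.
move=> m0; exists (4 + 2 * \sum_(k < n.+1) `|m k|).
have S0 : 0 <= \sum_(k < n.+1) `|m k| by exact: sumr_ge0.
have mS k : `|m k| <= \sum_(k < n.+1) `|m k|.
  case: (ltnP n k) => kn; first by rewrite m0 // normr0.
  by rewrite (bigD1 (inord k)) //= inordK // lerDl sumr_ge0.
split=> k.
  rewrite /free_offdiag; case: eqP => _; rewrite normrN ?normr1; last by lra.
  have := sqrtr_ge0 (2 : R); have := sqrt2_sq.
  by set r := Num.sqrt _ => r2 r0; rewrite ger0_norm //; nra.
rewrite /diag; apply: (le_trans (ler_normD _ _)); rewrite (@ger0_norm _ 2) //.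
case: eqP => _; first by rewrite normrM (@ger0_norm _ 2) //; have := mS 0%N; lra.
by have := mS k; have := normr_ge0 (m k); lra.
Qed.

Definition rform m x y : R := rdot x (rH m y) - 4 * rdot x y.

(* The sign change and the weight at 0 turn 4 - H into the Jacobi matrix with
   off-diagonal entries -1 and diagonal entries [mass m]. *)
Definition gauge x (k : nat) : R :=
  (-1) ^+ k * (if k == 0%N then Num.sqrt 2 else 1) * x k.

(** Entry 0 is half of 4 minus the diagonal entry, because [gauge] doubles the square there. *)
Definition mass m (k : nat) : R := if k == 0%N then 1 - m 0%N else 2 - m k.

Lemma gauge_mulS x k :
  gauge x k * gauge x k.+1 = free_offdiag k * (x k * x k.+1).
Proof.
rewrite /gauge /= exprS; set e := (-1) ^+ k.
have e2 : e ^+ 2 = 1 by rewrite sqrr_sign.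
rewrite -[LHS]mul1r -[RHS]mul1r /free_offdiag; case: eqP => _.
  by transitivity (- e ^+ 2 * Num.sqrt 2 * x k * x k.+1); [ring|rewrite e2; ring].
by transitivity (- e ^+ 2 * x k * x k.+1); [ring|rewrite e2; ring].
Qed.

Lemma gauge_sq x k : gauge x k ^+ 2 = (if k == 0%N then 2 else 1) * x k ^+ 2.
Proof.
rewrite /gauge !exprMn sqrr_sign mul1r.
by case: eqP => _; rewrite ?sqrt2_sq ?expr1n.
Qed.

(** Every off-diagonal product occurs twice in the sum over k <= l except the one of index [l],
    which the truncation leaves once; the added product cancels it. *)
Lemma partial_form m x l :
  \sum_(k < l.+1) x k * (4 * x k - rH m x k) + gauge x l * gauge x l.+1 =
  \sum_(k < l) (mass m k * gauge x k ^+ 2 - 2 * (gauge x k * gauge x k.+1)) +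
    mass m l * gauge x l ^+ 2.
Proof.
elim: l => [|l IH].
  rewrite big_ord1 big_ord0 gauge_mulS gauge_sq /rH /rjac /diag /mass /free_offdiag /=.
  by ring.
rewrite big_ord_recr [in RHS]big_ord_recr /= addrAC.
rewrite [X in _ = X + _ + _](_ : _ = \sum_(k < l.+1) x k * (4 * x k - rH m x k) +
   gauge x l * gauge x l.+1 - mass m l * gauge x l ^+ 2); last by rewrite IH addrK.
set S := \sum_(k < l.+1) x k * _.
have -> : rH m x l.+1 = free_offdiag l * x l + (2 + m l.+1) * x l.+1 + free_offdiag l.+1 * x l.+2.
  by [].
by rewrite !gauge_mulS !gauge_sq [mass m l.+1]/mass /=; ring.
Qed.

(** Beyond [n] the mass is 2, so the tail is a sum of squares of consecutive differences once it
    borrows one square of the entry at [n]. The mass at [n] pays for it, whence the correction at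
    [k == n]. *)
Lemma tail_form m x n l : (forall k, (n < k)%N -> m k = 0) ->
  \sum_(k < n.+1) ((mass m k - (k == n :> nat)%:R) * (if (k <= n)%N then gauge x k else 0) ^+ 2
     - 2 * ((if (k <= n)%N then gauge x k else 0) *
            (if (k < n)%N then gauge x k.+1 else 0)))
  <= \sum_(k < (n + l).+1) x k * (4 * x k - rH m x k)
     + gauge x (n + l) * gauge x (n + l).+1.
Proof.
move=> m0; rewrite partial_form.
rewrite big_ord_recr /= ltnn leqnn eqxx !mulr0 subr0.
rewrite (eq_bigr (fun k : 'I_n => mass m k * gauge x k ^+ 2 -
                         2 * (gauge x k * gauge x k.+1))); last first.
  by move=> k _; have kn := ltn_ord k; rewrite kn (ltnW kn) ltn_eqF // subr0.
rewrite mulrBl mul1r.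
suff : \sum_(k < n) (mass m k * gauge x k ^+ 2 - 2 * (gauge x k * gauge x k.+1)) +
    (mass m n * gauge x n ^+ 2 - gauge x n ^+ 2) <=
  \sum_(k < n + l) (mass m k * gauge x k ^+ 2 - 2 * (gauge x k * gauge x k.+1)) +
    (mass m (n + l) * gauge x (n + l) ^+ 2 - gauge x (n + l) ^+ 2).
  by have := sqr_ge0 (gauge x (n + l)); lra.
elim: l => [|l IH]; first by rewrite addn0.
apply: (le_trans IH); rewrite addnS big_ord_recr /=.
have -> : mass m (n + l).+1 = 2 by rewrite /mass /= m0 ?subr0 // ltnS leq_addr.
by have := sqr_ge0 (gauge x (n + l) - gauge x (n + l).+1); lra.
Qed.

Definition trunc n x (k : nat) : R := if (k <= n)%N then gauge x k else 0.

(** The Jost correction of the last entry is exactly the unit of mass that [tail_form] takes away at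
    [n]. *)
Lemma jost_rec n m k : (k <= n)%N ->
  jost n m 1 k.+1 = (mass m k - (k == n)%:R) * jost n m 1 k - preceding (jost n m 1) k.
Proof.
move=> kn.
have e : jost_poly m 1 k.+1 = mass m k * jost_poly m 1 k - preceding (jost_poly m 1) k.
  case: k {kn} => [|k]; first by rewrite jost_poly1 /mass /=; field.
  by rewrite jost_polySS /mass /=; ring.
have -> : preceding (jost n m 1) k = preceding (jost_poly m 1) k.
  by case: k kn {e} => [|k] kn //=; rewrite jostE // ltnW.
rewrite (jostE _ _ kn); have [<-|kn'] := eqVneq k n.
  by rewrite jost_last e /=; ring.
by rewrite jostE ?e ?subr0 // ltn_neqAle kn'.
Qed.

Lemma rform_le0 n m x : (forall k, (n < k)%N -> m k = 0) -> rl2 x ->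
  (forall k, (k <= n)%N -> sign_change (jost n m 1 k) (jost n m 1 k.+1) ->
     step_form (jost n m 1) (trunc n x) k = 0) ->
  rform m x x <= 0.
Proof.
move=> m0 hx van.
have [M [aM bM]] := rH_bounded m0.
have hH := rl2_rjac aM bM hx.
have c4 : cvgn (series (fun k => x k * (4 * x k))) by apply: rdot_cvg => //; exact: rl2Z.
have cH : cvgn (series (fun k => x k * rH m x k)) by exact: rdot_cvg.
rewrite -oppr_ge0 /rform opprB -rdotZr // /rdot -lim_seriesB //.
pose f := (fun k => x k * (4 * x k)) - (fun k => x k * rH m x k).
have cf : series f @ \oo --> limn (series f) by exact: is_cvg_seriesB.
rewrite -/f.
(* This is the cut product of [partial_form]; as it tends to 0, adding it to the partial sums leaves
   their limit unchanged. *)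
pose w k := free_offdiag k * x k * x k.+1.
have cw : w @ \oo --> 0.
  apply: cvg_series_cvg_0; apply: rdot_cvg; last exact: rl2_shift.
  exact: rl2_bounded_mul.
have c : (fun l => series f (n + l).+1 + w (n + l)%N) @ \oo --> limn (series f).
  rewrite -[limn _]addr0; apply: cvgD.
    rewrite -(cvg_shiftn n.+1) in cf.
    by under eq_fun do rewrite addnC -addnS; exact: cf.
  rewrite -(cvg_shiftn n) in cw.
  by under eq_fun do rewrite addnC; exact: cw.
rewrite -(cvg_lim _ c) //; apply: limr_ge; first by apply/cvg_ex; eexists; exact: c.
apply: nearW => l.
have -> : series f (n + l).+1 + w (n + l)%N =
  \sum_(k < (n + l).+1) x k * (4 * x k - rH m x k)
     + gauge x (n + l) * gauge x (n + l).+1.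
  rewrite gauge_mulS /w mulrA; congr (_ + _).
  rewrite /series /= big_mkord; apply: eq_bigr => k _.
  by rewrite /f !fctE mulrBr.
apply: le_trans (tail_form x l m0).
apply: (@sum_squares_last _ (fun k => mass m k - (k == n)%:R) (jost n m 1) (trunc n x)).
- by rewrite jostE.
- exact: jost_rec.
- exact: van.
- by apply: regularS; apply: jost_regular; rewrite oner_neq0.
- by rewrite /trunc ltnn.
Qed.

Lemma step_form_sum n q (I : finType) (c : I -> R) (v : I -> nat -> R) k :
  step_form q (trunc n (fun j => \sum_i c i * v i j)) k =
  \sum_i c i * step_form q (trunc n (v i)) k.
Proof.
have tr j : trunc n (fun j => \sum_i c i * v i j) j = \sum_i c i * trunc n (v i) j.
  rewrite /trunc; case: ifP => _; last by rewrite big1 // => i _; rewrite mulr0.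
  by rewrite /gauge mulr_sumr; apply: eq_bigr => i _; rewrite mulrCA.
rewrite /step_form !tr; case: eqP => _ //.
rewrite !mulr_sumr -sumrB; apply: eq_bigr => i _; ring.
Qed.

Lemma rform_sum n m (I : finType) (c : I -> R) (v : I -> nat -> R) :
  (forall k, (n < k)%N -> m k = 0) -> (forall i, rl2 (v i)) ->
  (forall i j, i != j -> rform m (v i) (v j) = 0) ->
  rform m (fun k => \sum_i c i * v i k) (fun k => \sum_i c i * v i k) =
  \sum_i c i ^+ 2 * rform m (v i) (v i).
Proof.
move=> m0 hv orth; have [M [aM bM]] := rH_bounded m0.
have hH i : rl2 (rH m (v i)) by exact: rl2_rjac.
have hc i : rl2 (fun k => c i * v i k) by exact: rl2Z.
have hS : rl2 (fun k => \sum_i c i * v i k) by exact: rl2_sum.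
have lin x : rl2 x -> rform m x (fun k => \sum_i c i * v i k) = \sum_i c i * rform m x (v i).
  move=> hx; rewrite /rform /rH rjac_sum.
  rewrite [X in rdot x X](_ : _ = fun k => \sum_i c i * rH m (v i) k); last first.
    by apply/funext => k; apply: eq_bigr => i _; rewrite rjacZ.
  rewrite !rdot_sumr // => [|i]; last exact: rl2Z.
  rewrite mulr_sumr -sumrB; apply: eq_bigr => i _.
  by rewrite !rdotZr //; ring.
rewrite lin //; apply: eq_bigr => i _.
have sym x y : rl2 x -> rl2 y -> rform m x y = rform m y x.
  move=> hx hy; rewrite /rform /rH (rjac_sym aM bM hx hy).
  by rewrite (rdotC y (rjac _ _ _)) (rdotC y x).
rewrite sym // lin // (bigD1 i) //= big1 ?addr0; first by ring.
by move=> j ji; rewrite orth ?mulr0 // eq_sym.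
Qed.

(** The form is nonpositive on vectors satisfying s linear conditions, one per sign change. Some
    nontrivial combination of s + 1 vectors satisfies them all, while by orthogonality its form is
    the sum of c_i^2 times the forms of the family. *)
Lemma no_positive_family n m s (v : 'I_s.+1 -> nat -> R) :
  (forall k, (n < k)%N -> m k = 0) -> variations (jost n m 1) n.+1 = s ->
  (forall i, rl2 (v i)) ->
  (forall i j, i != j -> rform m (v i) (v j) = 0) ->
  exists i, rform m (v i) (v i) <= 0.
Proof.
move=> m0 vs hv orth; apply: contrapT => noex.
have pos i : 0 < rform m (v i) (v i).
  by rewrite ltNge; apply/negP => le0; apply: noex; exists i.
pose bad (k : 'I_n.+1) := sign_change (jost n m 1 k) (jost n m 1 k.+1).
have bs : #|bad| = s.
  by rewrite -vs /variations -sum1_card big_mkcond /=; apply: eq_bigr => k _;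
    rewrite unfold_in; case: (bad k).
have [c [i0 ci0] van] :=
  common_zero (fun i (k : 'I_n.+1) => step_form (jost n m 1) (trunc n (v i)) k) bs.
have : rform m (fun k => \sum_i c i * v i k) (fun k => \sum_i c i * v i k) <= 0.
  apply: (@rform_le0 n) => // [|k kn ck]; first by apply: rl2_sum => i; exact: rl2Z.
  by rewrite step_form_sum; exact: (van (Ordinal (kn : (k < n.+1)%N))).
rewrite (rform_sum _ m0) //; apply/negP; rewrite -ltNge (bigD1 i0) //=.
apply: ltr_pwDl; first by rewrite mulr_gt0 // exprn_even_gt0.
by apply: sumr_ge0 => i _; rewrite mulr_ge0 ?sqr_ge0 // ltW.
Qed.

End threshold_form.

(** * Eigenvectors above the threshold *)

Section eigenvectors.
Context {R : realType}.
Implicit Types (m x y : nat -> R) (z t : R).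

(** Its image under [gauge] is sqrt 2 times [jost_poly m z k / z ^+ k]. *)
Definition jost_solution m z (k : nat) : R :=
  (-1) ^+ k * (if k == 0%N then 1 else Num.sqrt 2) * (jost_poly m z k / z ^+ k).

Lemma jost_solution0 m z : jost_solution m z 0 = 1.
Proof. by rewrite /jost_solution !expr0 /= !mul1r invr1. Qed.

Lemma rH_jost_solution m z : z != 0 ->
  rH m (jost_solution m z) = fun k => (2 + z + z^-1) * jost_solution m z k.
Proof.
move=> z0; have s2 := @sqrt2_sq R; apply/funext => -[|k].
  rewrite /rH /rjac /diag /free_offdiag jost_solution0 /jost_solution /=.
  transitivity (2 + 2 * m 0%N + Num.sqrt 2 ^+ 2 * (((1 + z ^+ 2) / 2 - m 0%N * z) / z)).
    by rewrite expr1; field.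
  by rewrite s2; field.
have zk : z ^+ k != 0 by rewrite expf_neq0.
have e : free_offdiag k * jost_solution m z k =
    (-1) ^+ k.+1 * Num.sqrt 2 * (jost_poly m z k / z ^+ k).
  rewrite /free_offdiag /jost_solution exprS; case: eqP => [->|_]; last by ring.
  by rewrite expr0 /=; ring.
have eS j : jost_solution m z j.+1 = (-1) ^+ j.+1 * Num.sqrt 2 * (jost_poly m z j.+1 / z ^+ j.+1).
  by [].
have -> : rH m (jost_solution m z) k.+1 = free_offdiag k * jost_solution m z k +
    (2 + m k.+1) * jost_solution m z k.+1 - jost_solution m z k.+2.
  by rewrite -[in RHS]mulN1r.
rewrite e !eS jost_polySS !exprS.
by field; rewrite z0 zk.
Qed.

(** The ratio of [jost_poly m z k] to z^(2k) is constant from [n] on, so its first n + 1 values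
    bound it. The estimate serves the eigenvectors for z < 1 and the resonance for z = 1. *)
Lemma jost_solution_bound n m z : (forall k, (n < k)%N -> m k = 0) -> 0 < z ->
  jost_poly m z n.+1 = z ^+ 2 * jost_poly m z n ->
  exists C : R, forall k, `|jost_solution m z k| <= C * z ^+ k.
Proof.
move=> m0 z0 zn.
have zk k : 0 < z ^+ k by rewrite exprn_gt0.
pose c k := `|jost_poly m z k| / (z ^+ 2) ^+ k.
have c0 k : 0 <= c k by rewrite divr_ge0 // exprn_ge0 // sqr_ge0.
exists (2 * \sum_(k < n.+1) c k) => k.
have cS : c k <= \sum_(k < n.+1) c k.
  case: (ltnP n k) => kn.
    have -> : c k = c n.
      rewrite /c -(subnKC (ltnW kn)) (jost_poly_tail _ m0 zn) normrM exprD.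
      rewrite ger0_norm; last by rewrite !exprn_ge0 // ltW.
      have := zk 2%N; set a := z ^+ 2 => a0.
      have := exprn_gt0 n a0; have := exprn_gt0 (k - n) a0.
      by move=> ? ?; field; rewrite !gt_eqF.
    by rewrite (bigD1 ord_max) //= lerDl sumr_ge0.
  by rewrite (bigD1 (inord k)) //= inordK // lerDl sumr_ge0.
have s1 : `|if k == 0%N then 1 else Num.sqrt 2| <= 2 :> R.
  case: eqP => _; first by rewrite normr1; lra.
  have := sqrtr_ge0 (2 : R); have := @sqrt2_sq R.
  by set r := Num.sqrt _ => r2 r0; rewrite ger0_norm //; nra.
rewrite /jost_solution !normrM normr_sign mul1r normfV (ger0_norm (ltW (zk k))).
rewrite -mulrA; apply: ler_pM => //; first by rewrite divr_ge0 // ltW.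
rewrite -ler_pdivrMr // -mulrA -invfM -expr2 -exprM mulnC exprM.
exact: cS.
Qed.

Lemma rl2_expr z : 0 < z < 1 -> rl2 (fun k => z ^+ k).
Proof.
move=> /andP[z0 z1].
rewrite /rl2 (_ : (fun k => _) = geometric 1 (z ^+ 2)).
  apply: is_cvg_geometric_series.
  by rewrite normrX ger0_norm ?expr_lt1 ?ltW.
by apply/funext => k; rewrite /geometric /= mul1r -!exprM mulnC.
Qed.

Lemma rl2_jost_solution n m z : (forall k, (n < k)%N -> m k = 0) -> 0 < z < 1 ->
  jost_poly m z n.+1 = z ^+ 2 * jost_poly m z n -> rl2 (jost_solution m z).
Proof.
move=> m0 z01 zn; have /andP[z0 _] := z01.
have [C hC] := jost_solution_bound m0 z0 zn.
apply: (@rl2_le _ _ (fun k => z ^+ k) C) (rl2_expr z01) => k.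
by rewrite (ger0_norm (exprn_ge0 _ (ltW z0))).
Qed.

(** The off-diagonal entries do not vanish, so the recurrence determines a solution from its entry
    0. *)
Lemma rH_eigen_unique m t x : rH m x = (fun k => t * x k) -> x 0%N = 0 ->
  forall k, x k = 0.
Proof.
move=> e x0.
have a0 k : free_offdiag k != 0 :> R.
  by rewrite /free_offdiag; case: (k == 0%N); rewrite oppr_eq0 ?oner_neq0 // sqrtr_eq0 -ltNge.
elim/ltn_ind => -[|k] IH //.
apply: (mulfI (a0 k)); rewrite mulr0.
have := congr1 (@^~ k) e; rewrite /rH /rjac (IH k (leqnn _)) !mulr0 addr0.
case: k IH => [|k] IH; first by rewrite add0r.
by rewrite (IH k (leqnSn _)) mulr0 add0r.
Qed.

Lemma rH_eigen_orth n m x y s t : (forall k, (n < k)%N -> m k = 0) ->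
  rl2 x -> rl2 y -> rH m x = (fun k => s * x k) -> rH m y = (fun k => t * y k) ->
  s != t -> rdot x y = 0.
Proof.
move=> m0 hx hy ex ey st; have [M [aM bM]] := rH_bounded m0.
have := rjac_sym aM bM hx hy; rewrite -/(rH m x) -/(rH m y) ex ey.
rewrite rdotZr // (rdotC (fun k => s * x k)) rdotZr // (rdotC y) => /eqP.
by rewrite -subr_eq0 -mulrBl mulf_eq0 subr_eq0 eq_sym (negbTE st) => /eqP.
Qed.

Lemma rform_eigenr m x y t : rl2 x -> rl2 y -> rH m y = (fun k => t * y k) ->
  rform m x y = (t - 4) * rdot x y.
Proof. by move=> hx hy e; rewrite /rform e rdotZr // mulrBl. Qed.

(** The zeros of the Jost function supply the eigenvectors. A vector [u] orthogonal to all of them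
    with a positive form would complete them to a family of s + 1 form-orthogonal vectors with
    positive forms. *)
Lemma threshold_eigenbasis n m : (forall k, (n < k)%N -> m k = 0) ->
  let s := variations (jost n m 1) n.+1 in
  exists (v : 'I_s -> nat -> R) (t : 'I_s -> R),
    [/\ forall i, [/\ rl2 (v i), v i 0%N = 1, 4 < t i
                    & rH m (v i) = fun k => t i * v i k],
        injective t
      & forall u, rl2 u -> (forall i, rdot (v i) u = 0) -> rform m u u <= 0].
Proof.
move=> m0 s; have [f [fz fi]] := jost_zeros n m.
have {}fz (i : 'I_s) := fz i (ltn_ord i).
have tE z : z != 0 -> 2 + z + z^-1 = 4 + (z - 1) ^+ 2 / z by move=> ?; field.
pose t (i : 'I_s) := 2 + f i + (f i)^-1; pose v (i : 'I_s) := jost_solution m (f i).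
have f0 i : 0 < f (nat_of_ord (i : 'I_s)) < 1 by case: (fz i).
have hv i : rl2 (v i) by case: (fz i) => ? ?; exact: (rl2_jost_solution m0).
have ev i : rH m (v i) = fun k => t i * v i k.
  by apply: rH_jost_solution; rewrite gt_eqF //; case/andP: (f0 i).
have t4 i : 4 < t i.
  have /andP[l0 l1] := f0 i; rewrite /t tE ?gt_eqF // ltrDl divr_gt0 //.
  by rewrite exprn_even_gt0 //= subr_eq0 lt_eqF.
have t_inj : injective t.
  move=> i j; wlog ij : i j / (i < j)%N.
    move=> wl e; have [ij|ij|/val_inj //] := ltngtP i j; first exact: wl.
    by apply/esym; exact: wl.
  move=> e; have := fi _ _ ij (ltn_ord j); move: e; rewrite /t.
  have /andP[] := f0 i; have /andP[] := f0 j.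
  set a := f i; set b := f j => b0 b1 a0 a1 e /eqP[].
  (* Two parameters with the same z + 1/z are equal or inverse to each other, and both lie below
     1. *)
  have h : (a - b) * (a * b - 1) = 0.
    have -> : (a - b) * (a * b - 1) = ((2 + a + a^-1) - (2 + b + b^-1)) * (a * b).
      by field; rewrite !gt_eqF.
    by rewrite e subrr mul0r.
  move/eqP: h; rewrite mulf_eq0 => /orP[/eqP h|/eqP h]; first by lra.
  by nra.
have v_gt0 i : 0 < rdot (v i) (v i).
  by apply: (rdot_gt0 (k := 0%N)) => //; rewrite /v jost_solution0 oner_neq0.
exists v, t; split=> // [i|u hu orth]; first by split; rewrite // /v jost_solution0.
pose w (i : 'I_s.+1) := if unlift ord_max i is Some j then v j else u.
have hw i : rl2 (w i) by rewrite /w; case: unlift.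
have [|i] := @no_positive_family _ n m s w m0 erefl hw.
  move=> i j; rewrite /w; case: unliftP => [i' ->|->]; case: unliftP => [j' ->|->].
  - rewrite (inj_eq lift_inj) => ij; rewrite (rform_eigenr _ _ (ev j')) //.
    rewrite (rH_eigen_orth m0 _ _ (ev i') (ev j')) ?mulr0 //.
    by apply: contraNneq ij => /t_inj ->.
  - have [M [aM bM]] := rH_bounded m0.
    rewrite /rform /rH (rjac_sym aM bM) // -/(rH m (v i')) ev rdotC rdotZr //.
    by rewrite (rdotC u) orth !mulr0 subr0.
  - by rewrite (rform_eigenr _ _ (ev j')) // rdotC orth mulr0.
  - by rewrite eqxx.
rewrite /w; case: unliftP => [j _|_ //].
rewrite (rform_eigenr _ _ (ev j)) // leNgt => /negP[].
by rewrite mulr_gt0 // subr_gt0.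
Qed.

End eigenvectors.

(** * Spectral projections *)

Section mean_value.
Context {R : realType}.

Definition above4 : set (measurableTypeR R) := `]4, +oo[%classic.
Definition below4 : set (measurableTypeR R) := `]-oo, 4]%classic.

Lemma measurable_above4 : measurable above4.
Proof. exact: measurable_itv. Qed.

Lemma measurable_below4 : measurable below4.
Proof. exact: measurable_itv. Qed.

#[local] Hint Resolve measurable_above4 measurable_below4 : core.
Variables (m : {measure set (measurableTypeR R) -> \bar R}) (M e : R).
Hypotheses (mT : m setT = M%:E).
Hypothesis (int_id : m.-integrable setT (fun t : measurableTypeR R => t%:E)).
Hypothesis (mean : e%:E = (\int[m]_t t%:E)%E).

Let f (t : measurableTypeR R) : \bar R := (t - 4)%:E.

Let integrable_cst4 : m.-integrable setT (EFin \o cst (4 : R)).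
Proof.
apply/integrableP; split; first exact/measurable_EFinP/measurable_cst.
rewrite (eq_integral (cst (4 : R)%:E)); last by move=> x _ /=; rewrite ger0_norm.
by rewrite integral_cst // [m _]mT -EFinM ltry.
Qed.

Let integrable_shift : m.-integrable setT f.
Proof.
rewrite (_ : f = ((fun t : measurableTypeR R => t%:E) \- (EFin \o cst (4 : R)%R))%E) //.
by apply: integrableB.
Qed.

Let integral_shift : (\int[m]_t f t = (e - 4 * M)%:E)%E.
Proof.
rewrite EFinB mean EFinM -mT -(integral_cst m measurableT).
rewrite -(integralB measurableT int_id integrable_cst4).
by apply: eq_integral => x _; rewrite /f EFinB.
Qed.

Lemma mean_le4 : m above4 = 0%E -> e <= 4 * M.
Proof.
move=> m0; rewrite -subr_le0 -lee_fin -integral_shift.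
rewrite (negligible_integral (N := above4)) //.
rewrite (eq_integral (fun t => - (- f t))%E); last by move=> x _; rewrite oppeK.
have f0 x : (setT `\` above4) x -> (0 <= - f x)%E.
  by move=> [_]; rewrite /above4 /= in_itv /= andbT => /negP; rewrite -leNgt lee_fin => ?; lra.
by rewrite integral_ge0N // oppe_le0 integral_ge0.
Qed.

(** Otherwise [t - 4], positive almost everywhere, would have a nonpositive integral, hence vanish
    almost everywhere, which leaves no mass at all. *)
Lemma mean_gt4 : 0 < M -> m below4 = 0%E -> 4 * M < e.
Proof.
move=> M0 m0; rewrite ltNge; apply/negP => le.
have mf : measurable_fun setT f by case/integrableP: integrable_shift.
have abs0 : (\int[m]_t `|f t| = 0)%E.
  apply/eqP; rewrite eq_le integral_ge0 ?andbT //.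
  rewrite (negligible_integral (N := below4)) //; last first.
    exact: integrable_abse.
  rewrite (eq_integral f) => [|x].
    by rewrite -(negligible_integral (N := below4)) // integral_shift lee_fin; lra.
  rewrite inE => -[_]; rewrite /below4 /= in_itv /= => /negP; rewrite -ltNge => x4.
  by rewrite ger0_norm //; lra.
move/(ae_eq_integral_abs m measurableT mf): abs0 => [A [mA A0 sub]].
have : (m setT <= m below4 + m A)%E.
  apply: (le_trans _ (measureU2 _ _ _)) => //.
  apply: le_measure; rewrite ?inE //; first exact: measurableU.
  move=> x _; have [x4|x4] := leP x 4; first by left; rewrite /below4 /= in_itv.
  by right; apply: sub => /= /(_ Logic.I); rewrite /f => -[] ?; lra.
by rewrite m0 [m A]A0 mT adde0 lee_fin leNgt M0.
Qed.

End mean_value.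

(** * Reduction of complex sequences to real ones *)

Section complex_l2.
Context {R : realType}.
Implicit Types x y : nat -> R[i].

Definition re x (k : nat) : R := complex.Re (x k).
Definition im x (k : nat) : R := complex.Im (x k).
Definition cx (u : nat -> R) (k : nat) : R[i] := (u k)%:C%C.

Lemma re_im_eq x y : re x = re y -> im x = im y -> x = y.
Proof.
move=> e1 e2; apply/funext => k; have := congr1 (@^~ k) e1; have := congr1 (@^~ k) e2.
by rewrite /re /im; case: (x k) (y k) => [a b] [c d] /= -> ->.
Qed.

Lemma re_lincomb (c : R) x y :
  re (lincomb c%:C%C x y) = fun k => c * re x k + re y k.
Proof.
apply/funext => k; rewrite /re /lincomb; case: (x k) (y k) => [a b] [a' b'] /=.
by rewrite mul0r subr0.
Qed.

Lemma im_lincomb (c : R) x y :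
  im (lincomb c%:C%C x y) = fun k => c * im x k + im y k.
Proof.
apply/funext => k; rewrite /im /lincomb; case: (x k) (y k) => [a b] [a' b'] /=.
by rewrite mul0r addr0.
Qed.

Lemma eseries_lt_pinfty (f : nat -> R) : (forall k, 0 <= f k) ->
  (\sum_(k <oo) (f k)%:E < +oo)%E <-> cvgn (series f).
Proof.
move=> f0; split=> h; first exact: nnseries_is_cvg.
rewrite (_ : (fun n => _) = EFin \o series f); first by rewrite EFin_lim // ltry.
by apply/funext => n; rewrite /= /series /= sumEFin.
Qed.

Lemma l2P x : l2 x <-> rl2 (re x) /\ rl2 (im x).
Proof.
rewrite /l2 eseries_lt_pinfty => [|k]; last by rewrite addr_ge0 ?sqr_ge0.
split=> [h|[hr hi]]; last exact: (is_cvg_seriesD hr hi).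
by split; apply: series_le_cvg h => k; rewrite /re /im ?addr_ge0 ?sqr_ge0 //
  ?lerDl ?lerDr ?sqr_ge0.
Qed.

Lemma l2_lincomb (c : R) x y : l2 x -> l2 y -> l2 (lincomb c%:C%C x y).
Proof.
move=> /l2P[xr xi] /l2P[yr yi]; apply/l2P; rewrite re_lincomb im_lincomb.
by split; apply: rl2D => //; exact: rl2Z.
Qed.

Lemma re_cx (u : nat -> R) : re (cx u) = u.
Proof. by []. Qed.

Lemma im_cx (u : nat -> R) : im (cx u) = fun=> 0.
Proof. by []. Qed.

Lemma l2_cx (u : nat -> R) : rl2 u -> l2 (cx u).
Proof. by move=> hu; apply/l2P; split=> //; exact: rl2_0. Qed.

Lemma dot_cx (u : nat -> R) y :
  dot (cx u) y = (rdot u (re y) +i* rdot u (im y))%C.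
Proof.
rewrite /dot /rdot; congr (_ +i* _)%C; congr (limn (series _)); apply/funext => k.
  by rewrite /re /cx; case: (y k) => [a b] /=; rewrite oppr0 mul0r subr0.
by rewrite /im /cx; case: (y k) => [a b] /=; rewrite oppr0 mul0r addr0.
Qed.

Definition re_dot x y : R := complex.Re (dot x y).

Lemma re_dotE x y : l2 x -> l2 y -> re_dot x y = rdot (re x) (re y) + rdot (im x) (im y).
Proof.
move=> /l2P[xr xi] /l2P[yr yi]; rewrite /re_dot /dot /= /rdot -lim_seriesD; try exact: rdot_cvg.
congr (limn (series _)); apply/funext => k; rewrite !fctE /re /im.
by case: (x k) (y k) => [a b] [c d] /=; rewrite mulNr opprK.
Qed.

Lemma re_dotC x y : l2 x -> l2 y -> re_dot x y = re_dot y x.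
Proof. by move=> hx hy; rewrite !re_dotE // rdotC (rdotC (im x)). Qed.

Lemma re_dot_lincombr (c : R) x y z : l2 x -> l2 y -> l2 z ->
  re_dot x (lincomb c%:C%C y z) = c * re_dot x y + re_dot x z.
Proof.
move=> hx hy hz; rewrite (re_dotE hx (l2_lincomb c hy hz)) (re_dotE hx hy) (re_dotE hx hz).
rewrite re_lincomb im_lincomb.
move: hx hy hz => /l2P[xr xi] /l2P[yr yi] /l2P[zr zi].
by rewrite !rdotDr ?rdotZr //; [ring|exact: rl2Z|exact: rl2Z].
Qed.

Lemma re_dot_lincombl (c : R) x y z : l2 x -> l2 y -> l2 z ->
  re_dot (lincomb c%:C%C x y) z = c * re_dot x z + re_dot y z.
Proof.
move=> hx hy hz; rewrite (re_dotC (l2_lincomb c hx hy) hz) re_dot_lincombr //.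
by rewrite (re_dotC hx hz) (re_dotC hy hz).
Qed.

Lemma re_dot_gt0 x k : l2 x -> x k != 0 -> 0 < re_dot x x.
Proof.
move=> hx xk; rewrite re_dotE //; move: hx => /l2P[xr xi].
have : (re x k != 0) || (im x k != 0).
  by move: xk; rewrite /re /im; case: (x k) => [a b]; rewrite eq_complex negb_and.
case/orP => h; first by apply: ltr_pwDl; [exact: rdot_gt0 h|exact: rdot_ge0].
by apply: ltr_wpDl; [exact: rdot_ge0|exact: rdot_gt0 h].
Qed.

Lemma re_dot_le0 x : l2 x -> re_dot x x <= 0 -> x = fun=> 0.
Proof.
move=> hx le; apply/funext => k; apply/eqP/negPn/negP => /(re_dot_gt0 hx).
by rewrite ltNge le.
Qed.

End complex_l2.

Section operator.
Context {R : realType} (n : nat) (nu : 'rV[R]_n.+1).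
Implicit Types x y a b : nat -> R[i].

Lemma ext_tail k : (n < k)%N -> ext nu k = 0.
Proof. by move=> nk; rewrite /ext insubF // ltnS leqNgt nk. Qed.

Lemma re_H x : re (H nu x) = rH (ext nu) (re x).
Proof.
apply/funext => -[|k]; rewrite /re /H /jacobi /rH /rjac /diag /potential /=.
  by case: (x 0%N) (x 1%N) => [a b] [c d] /=; rewrite !mul0r !subr0 !add0r.
by case: (x k) (x k.+1) (x k.+2) => [a b] [c d] [e f] /=; rewrite !mul0r !subr0.
Qed.

Lemma im_H x : im (H nu x) = rH (ext nu) (im x).
Proof.
apply/funext => -[|k]; rewrite /im /H /jacobi /rH /rjac /diag /potential /=.
  by case: (x 0%N) (x 1%N) => [a b] [c d] /=; rewrite !mul0r !addr0 !add0r.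
by case: (x k) (x k.+1) (x k.+2) => [a b] [c d] [e f] /=; rewrite !mul0r !addr0.
Qed.

Lemma l2_H x : l2 x -> l2 (H nu x).
Proof.
have [M [aM bM]] := rH_bounded ext_tail.
by move=> /l2P[xr xi]; apply/l2P; rewrite re_H im_H; split; exact: rl2_rjac.
Qed.

Lemma H_lincomb (c : R[i]) x y : H nu (lincomb c x y) = lincomb c (H nu x) (H nu y).
Proof.
by apply/funext => -[|k]; rewrite /H /jacobi /lincomb; ring.
Qed.

Lemma re_dot_H_sym x y : l2 x -> l2 y -> re_dot x (H nu y) = re_dot y (H nu x).
Proof.
move=> hx hy; have [M [aM bM]] := rH_bounded ext_tail.
rewrite !re_dotE //; try exact: l2_H.
rewrite !re_H !im_H /rH; move: hx hy => /l2P[xr xi] /l2P[yr yi].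
rewrite (rjac_sym aM bM xr yr) (rjac_sym aM bM xi yi).
by rewrite (rdotC (re y)) (rdotC (im y)).
Qed.

Lemma re_dot_H_rform x : l2 x ->
  re_dot x (H nu x) - 4 * re_dot x x =
  rform (ext nu) (re x) (re x) + rform (ext nu) (im x) (im x).
Proof.
move=> hx; rewrite !re_dotE //; last exact: l2_H.
by rewrite re_H im_H /rform; ring.
Qed.

Lemma H_cx (v : nat -> R) : H nu (cx v) = cx (rH (ext nu) v).
Proof.
apply: re_im_eq; first by rewrite re_H.
by rewrite im_H !im_cx; apply/funext => -[|k]; rewrite /rH /rjac; ring.
Qed.

End operator.

Lemma cvg_finsum (R : realType) (I : Type) (r : seq I) (f : I -> nat -> R) (l : I -> R) :
  (forall i, f i @ \oo --> l i) ->
  (fun k => \sum_(i <- r) f i k) @ \oo --> \sum_(i <- r) l i.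
Proof.
move=> h; elim: r => [|i r IH].
  by under eq_fun do rewrite big_nil; rewrite big_nil; exact: cvg_cst.
under eq_fun do rewrite big_cons.
by rewrite big_cons; apply: cvgD.
Qed.

(** * The trace of the spectral projection onto (4, oo) *)

Section spectral_trace.
Context {R : realType} (n : nat) (nu : 'rV[R]_n.+1).
Variable E : set (measurableTypeR R) -> (nat -> R[i]) -> nat -> R[i].
Hypothesis hE : is_spectral_measure (H nu) E.
Implicit Types x y a b : nat -> R[i].

Let P := E above4.

Let lc1 x y := lincomb (1 : R)%:C%C x y.

Lemma proj_l2 S x : measurable S -> l2 x -> l2 (E S x).
Proof. by case: hE => h _ _ _ /h[hl _ _ _]; exact: hl. Qed.

Lemma proj_lincomb S (c : R) x y : measurable S -> l2 x -> l2 y ->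
  E S (lincomb c%:C%C x y) = lincomb c%:C%C (E S x) (E S y).
Proof. by case: hE => h _ _ _ /h[_ hl _ _]; exact: hl. Qed.

Lemma proj_sym S x y : measurable S -> l2 x -> l2 y -> dot (E S x) y = dot x (E S y).
Proof. by case: hE => h _ _ _ /h[_ _ hs _]; exact: hs. Qed.

Lemma proj_idem S x : measurable S -> l2 x -> E S (E S x) = E S x.
Proof. by case: hE => h _ _ _ /h[_ _ _ hi]; exact: hi. Qed.

Lemma proj_setT x : l2 x -> E setT x = x.
Proof. by case: hE => _ h _ _; exact: h. Qed.

Lemma projI S T x : measurable S -> measurable T -> l2 x -> E (S `&` T) x = E S (E T x).
Proof. by case: hE => _ _ h _; exact: h. Qed.

Lemma scalar_measure x : l2 x ->
  exists m : {measure set (measurableTypeR R) -> \bar R},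
    [/\ forall S, measurable S -> m S = (re_dot x (E S x))%:E,
        m.-integrable setT (fun t : measurableTypeR R => t%:E)
      & (re_dot x (H nu x))%:E = (\int[m]_t t%:E)%E].
Proof. by case: hE => _ _ _ h; exact: h. Qed.

Lemma proj0 S : measurable S -> E S (fun=> 0) = fun=> 0.
Proof.
move=> mS; have h0 : l2 (fun=> 0 : R[i]) by apply/l2P; split; exact: rl2_0.
have e : lincomb (1 : R)%:C%C (fun=> 0 : R[i]) (fun=> 0) = fun=> 0.
  by apply/funext => k; rewrite /lincomb mulr0 addr0.
have := proj_lincomb 1 mS h0 h0; rewrite e => {}e; apply/funext => k.
have := congr1 (@^~ k) e; rewrite /lincomb mul1r => /eqP.
by rewrite -subr_eq0 opprD addrA subrr sub0r oppr_eq0 => /eqP.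
Qed.

(** If [P] fixes [x], all the mass of its scalar measure lies above 4, and none is left for
    [below4]. *)
Lemma re_dot_proj_pos x k : l2 x -> P x = x -> x k != 0 -> 4 * re_dot x x < re_dot x (H nu x).
Proof.
move=> hx Px xk; have [m [mS intm mean]] := scalar_measure hx.
have mT : m setT = (re_dot x x)%:E by rewrite mS // proj_setT.
apply: (mean_gt4 mT intm mean); first exact: re_dot_gt0 xk.
have /eqP : (m setT = m above4 + m below4)%E.
  rewrite -measureU; [|exact: measurable_above4|exact: measurable_below4|].
    congr (m _); apply/seteqP; split=> // t _; rewrite /above4 /below4 /= !in_itv /= andbT.
    by case: (leP t 4); [right|left].
  apply/seteqP; split=> [t|t []]; rewrite /above4 /below4 /= !in_itv /= andbT => -[h].
  by rewrite leNgt h.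
rewrite (mS _ measurable_above4) -/P Px mT; have mb := mS _ measurable_below4.
rewrite mb -EFinD eqe -[X in X == _]addr0 => /eqP/addrI <-.
by [].
Qed.

Lemma re_dot_proj_nonpos x : l2 x -> P x = (fun=> 0) -> re_dot x (H nu x) <= 4 * re_dot x x.
Proof.
move=> hx Px; have [m [mS intm mean]] := scalar_measure hx.
have mT : m setT = (re_dot x x)%:E by rewrite mS // proj_setT.
apply: (mean_le4 mT intm mean); rewrite (mS _ measurable_above4) -/P Px.
rewrite re_dotE //; last by apply/l2P; split; exact: rl2_0.
by rewrite /re /im /= !rdot0r addr0.
Qed.

(** The spectral measure determines H only through quadratic forms, so the cross term is reached by
    polarization: the scalar measure of a + b is the sum of those of a and b, and hence so is its
    mean. *)
Lemma re_dot_H_cross a b : l2 a -> l2 b -> P a = a -> P b = (fun=> 0) ->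
  re_dot a (H nu b) = 0.
Proof.
move=> ha hb Pa Pb.
have hab : l2 (lc1 a b) by exact: l2_lincomb.
have [m [mS intm mean]] := scalar_measure hab.
have [ma [maS intma meana]] := scalar_measure ha.
have [mb [mbS intmb meanb]] := scalar_measure hb.
have h0 : l2 (fun=> 0 : R[i]) by apply/l2P; split; exact: rl2_0.
have rd0 x : l2 x -> re_dot x (fun=> 0) = 0.
  by move=> hx; rewrite re_dotE // /re /im /= !rdot0r addr0.
(* [P] moves from [a] across the product, commutes with [E S] through the intersection, and kills
   [b]. *)
have cross S : measurable S -> re_dot a (E S b) = 0.
  move=> mS'; rewrite -{1}Pa /re_dot proj_sym //; try exact: measurable_above4; last exact: proj_l2.
  rewrite -/(re_dot _ _) -projI //; last exact: measurable_above4.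
  rewrite setIC projI //; last exact: measurable_above4.
  by rewrite -/P Pb proj0 // rd0.
have mD S : measurable S -> m S = measure_add ma mb S.
  move=> mS'; rewrite measure_addE (mS _ mS') (maS _ mS') (mbS _ mS') -EFinD; congr EFin.
  have hEa := proj_l2 mS' ha; have hEb := proj_l2 mS' hb.
  rewrite proj_lincomb // re_dot_lincombr // !re_dot_lincombl // cross // !mul1r.
  have -> : re_dot b (E S a) = 0 by rewrite /re_dot -proj_sym // -/(re_dot _ _) re_dotC // cross.
  by rewrite addr0 add0r.
have : re_dot (lc1 a b) (H nu (lc1 a b)) = re_dot a (H nu a) + re_dot b (H nu b).
  apply: EFin_inj; rewrite EFinD meana meanb mean -integral_measure_add //.
  by apply: eq_measure_integral => S mS' _; exact: mD.
have hHa := l2_H nu ha; have hHb := l2_H nu hb.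
rewrite /lc1 H_lincomb re_dot_lincombr // ?l2_lincomb //; try exact: l2_lincomb.
rewrite !re_dot_lincombl // !mul1r (re_dot_H_sym _ hb ha); lra.
Qed.

(** Put u = x - P x. Since u and P x are orthogonal, also in the form of H, the form of H at u is t
    times its squared norm; as P u = 0 it is at most 4 times that. Hence u = 0. *)
Lemma proj_eigenvector (t : R) x : l2 x -> 4 < t -> H nu x = (fun k => t%:C%C * x k) ->
  P x = x.
Proof.
move=> hx t4 e; have mP := measurable_above4 (R := R).
have ha : l2 (P x) by exact: proj_l2.
pose u := lincomb (- 1 : R)%:C%C (P x) x.
have hu : l2 u by exact: l2_lincomb.
have Pu : P u = fun=> 0.
  rewrite /P proj_lincomb // proj_idem //; apply/funext => k.
  by rewrite /lincomb rmorphN mulN1r addNr.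
have xE : x = lincomb (1 : R)%:C%C (P x) u.
  by apply/funext => k; rewrite /u /lincomb rmorphN rmorph1 mul1r mulN1r addrA subrr add0r.
have Pa : P (P x) = P x by exact: proj_idem.
have h1 : re_dot u (H nu x) = re_dot u (H nu u).
  rewrite {1}xE H_lincomb re_dot_lincombr //; try exact: l2_H.
  by rewrite re_dot_H_sym // re_dot_H_cross // mulr0 add0r.
have h2 : re_dot u (H nu x) = t * re_dot u x.
  have -> : H nu x = lincomb t%:C%C x (fun=> 0).
    by rewrite e; apply/funext => k; rewrite /lincomb addr0.
  rewrite re_dot_lincombr //; last by apply/l2P; split; exact: rl2_0.
  rewrite [X in _ + X]re_dotE //; last by apply/l2P; split; exact: rl2_0.
  by rewrite /re /im /= !rdot0r !addr0.
have h3 : re_dot u x = re_dot u u.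
  rewrite {1}xE re_dot_lincombr // (_ : re_dot u (P x) = 0) ?mulr0 ?add0r //.
  rewrite re_dotC // /re_dot -{1}Pa /P proj_sym // -/P Pu -/(re_dot _ _).
  rewrite re_dotE //; last by apply/l2P; split; exact: rl2_0.
  by rewrite /re /im /= !rdot0r addr0.
have := re_dot_proj_nonpos hu Pu; rewrite -h1 h2 h3 => le.
have u0 : u = fun=> 0.
  by apply: re_dot_le0 => //; rewrite -(pmulr_rle0 _ (_ : 0 < t - 4)) ?subr_gt0 // mulrBl subr_le0.
rewrite [RHS]xE u0; apply/funext => k.
by rewrite /lincomb mul1r addr0.
Qed.

(** [P] is the orthogonal projection onto the span of the [v i]: it fixes them, and kills their
    complement because a nonzero vector there in its range would have both a positive and a
    nonpositive form of H - 4. *)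
Lemma trace_spectral_projection :
  trace (E `]4, +oo[%classic) = (variations (jost n (ext nu) 1) n.+1)%:R%:E.
Proof.
rewrite -/above4 -/P; have mP := measurable_above4 (R := R).
have [v [t [hv t_inj max]]] := threshold_eigenbasis (ext_tail nu).
set s := variations _ _ in v t hv t_inj max *.
have hl i : rl2 (v i) by case: (hv i).
have Pv i : P (cx (v i)) = cx (v i).
  have [_ _ t4 ev] := hv i; apply: (proj_eigenvector (l2_cx (hl i)) t4).
  by rewrite H_cx ev; apply/funext => k; rewrite /cx rmorphM.
have Pperp y : l2 y -> (forall i, dot (cx (v i)) y = 0) -> P y = fun=> 0.
  move=> hy orth; have hw : l2 (P y) by exact: proj_l2.
  have orthw i : rdot (v i) (re (P y)) = 0 /\ rdot (v i) (im (P y)) = 0.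
    have := orth i; rewrite -{1}(Pv i) /P proj_sym //; last exact: l2_cx.
    by rewrite dot_cx => -[].
  apply/funext => k; apply/eqP/negPn/negP => /(re_dot_proj_pos hw (proj_idem mP hy)).
  rewrite -subr_gt0 re_dot_H_rform // ltNge; apply/negP; rewrite negbK.
  move: (hw) => /l2P[hr hi].
  by rewrite -(addr0 0) lerD // max // => i; case: (orthw i).
have vgt0 i : 0 < rdot (v i) (v i).
  by apply: (rdot_gt0 (k := 0%N)) => //; case: (hv i) => _ ->; rewrite oner_neq0.
(* The coefficients of the k-th basis vector along the orthogonal family [v]; [S k] is then its
   projection. *)
pose c (k : nat) i := v i k / rdot (v i) (v i).
pose S (k : nat) := fun j => \sum_i c k i * v i j.
have hS k : rl2 (S k) by apply: rl2_sum => i; exact: rl2Z.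
have PS k : P (cx (S k)) = cx (S k).
  rewrite /S; elim: (index_enum _) => [|i r IH].
    rewrite (_ : cx _ = fun=> 0); first exact: proj0.
    by apply/funext => j; rewrite /cx /= big_nil.
  rewrite (_ : cx _ = lincomb (c k i)%:C%C (cx (v i)) (cx (fun j => \sum_(i <- r) c k i * v i j))).
    have hr : l2 (cx (fun j => \sum_(i <- r) c k i * v i j)).
      by apply/l2_cx/rl2_sum => i'; exact: rl2Z.
    by rewrite /P (proj_lincomb _ mP (l2_cx (hl i)) hr) -/P IH Pv.
  by apply/funext => j; rewrite /cx /lincomb /= big_cons rmorphD rmorphM.
pose del (k : nat) : nat -> R := fun j => (j == k)%:R.
have rdot_del k u : rdot (del k) u = u k.
  rewrite /rdot; apply: lim_near_cst => //; near=> N; rewrite /series /= big_mkord.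
  have kN : (k < N)%N by near: N; exact: nbhs_infty_gt.
  rewrite (bigD1 (Ordinal kN)) //= /del eqxx mul1r big1 ?addr0 // => i.
  by rewrite -val_eqE /= => /negbTE ->; rewrite mul0r.
have hdel k : rl2 (del k).
  rewrite /rl2; apply/cvg_ex; exists 1; apply: cvg_near_cst; near=> N.
  rewrite /series /= big_mkord.
  have kN : (k < N)%N by near: N; exact: nbhs_infty_gt.
  rewrite (bigD1 (Ordinal kN)) //= /del eqxx expr1n big1 ?addr0 // => i.
  by rewrite -val_eqE /= => /negbTE ->; rewrite expr0n.
have Pbasis k : P (Defs.basis k) = cx (S k).
  pose y j := - 1 * S k j + del k j.
  have hy : rl2 y by apply: rl2D => //; exact: rl2Z.
  have -> : Defs.basis k = lincomb (1 : R)%:C%C (cx (S k)) (cx y).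
    apply/funext => j; rewrite /Defs.basis /lincomb /cx /y /del mul1r -rmorphD mulN1r.
    by rewrite addrA subrr add0r; case: eqP.
  rewrite /P (proj_lincomb _ mP (l2_cx (hS k)) (l2_cx hy)) -/P PS (Pperp (cx y)); first last.
  - move=> i; rewrite dot_cx im_cx rdot0r re_cx /y.
    rewrite rdotDr //; last exact: rl2Z.
    rewrite rdotZr // /S rdot_sumr //; last by move=> j; exact: rl2Z.
    rewrite (bigD1 i) //= big1 ?addr0.
      rewrite rdotZr // /c divfK ?gt_eqF // rdotC rdot_del mulN1r addNr.
      by [].
    move=> j ji; rewrite rdotZr // (rH_eigen_orth (ext_tail nu) (s := t i) (t := t j)) ?mulr0 //.
    + by case: (hv i).
    + by case: (hv j).
    + by apply: contraNneq ji => /t_inj ->.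
  - exact: l2_cx.
  by apply/funext => j; rewrite /lincomb mul1r addr0.
have term k : complex.Re (dot (Defs.basis k) (P (Defs.basis k))) =
    \sum_i (v i k * v i k) / rdot (v i) (v i).
  have -> : Defs.basis k = cx (del k) by apply/funext => j; rewrite /Defs.basis /cx /del; case: eqP.
  rewrite dot_cx /= rdot_del.
  have <- : Defs.basis k = cx (del k) by apply/funext => j; rewrite /Defs.basis /cx /del; case: eqP.
  rewrite Pbasis re_cx /S; apply: eq_bigr => i _; rewrite /c; ring.
rewrite /trace; apply: cvg_lim => //.
rewrite (_ : (fun N => _) = EFin \o series (fun k => \sum_i (v i k * v i k) / rdot (v i) (v i))).
  apply: cvg_EFin; first by apply: nearW.
  (* After exchanging the sums, each [v i] contributes its squared norm divided by itself, that is
     1. *)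
  rewrite (_ : fine \o _ = fun N => \sum_i (rdot (v i) (v i))^-1 *
       series (fun k => v i k * v i k) N).
    rewrite (_ : s%:R = \sum_(i < s) (rdot (v i) (v i))^-1 * rdot (v i) (v i)); last first.
      rewrite (eq_bigr (fun=> 1)) ?sumr_const ?card_ord // => i _.
      by rewrite mulVf // gt_eqF.
    apply: cvg_finsum => i; apply: cvgM; first exact: cvg_cst.
    exact: rdot_cvg.
  apply/funext => N; rewrite /series /= exchange_big /=; apply: eq_bigr => i _.
  by rewrite mulr_sumr; apply: eq_bigr => k _; rewrite mulrC.
apply/funext => N; rewrite /= /series /= -sumEFin; apply: eq_bigr => k _.
by rewrite -term.
Unshelve. all: by end_near. Qed.

End spectral_trace.

(** * The graph condition, the resonance and the eigenvalues *)

Section conclusion.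
Context {R : realType} (n : nat) (mu : 'rV[R]_n.+1).

Lemma ext_opp k : ext (- mu) k = - ext mu k.
Proof. by rewrite /ext; case: insub => [i|]; rewrite ?mxE ?oppr0. Qed.

Lemma jost_poly1_Qseq k : jost_poly (ext mu) 1 k = Qseq (ext (- mu)) k.
Proof. by apply: jost_poly_Qseq => i _; exact: ext_opp. Qed.

Lemma Qseq_init k : (k <= n)%N -> Qseq (ext (init (- mu))) k = Qseq (ext (- mu)) k.
Proof. by move=> kn; apply: eq_Qseq => i ik; rewrite ext_init // (leq_trans ik). Qed.

(** The Jost function at z = 1 is Q_n times [lastc (- mu) - (Phi (init (- mu)) + 1)]. *)
Lemma jost_graph : Q (init (- mu)) != 0 ->
  jost n (ext mu) 1 n.+1 = 0 <-> lastc (- mu) = Phi (init (- mu)) + 1.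
Proof.
rewrite jost_last !jost_poly1_Qseq expr1n mul1r -(ext_lastc (- mu)).
case: n mu => [|p] nu.
  by rewrite /Phi /= => _; split=> ?; lra.
rewrite QseqSS /Phi /Q.
have eQ k : (k <= p.+1)%N -> Qseq (ext (init (- nu))) k = Qseq (ext (- nu)) k.
  by move=> kn; apply: eq_Qseq => i ik; rewrite ext_init // (leq_trans ik).
rewrite !eQ //; set a := Qseq _ p.+1; set b := Qseq _ p; set l := ext _ _ => a0.
have -> : (2 + l) * a - b - a = a * (l - (b / a - 2 + 1)) by field.
split=> [/eqP|->]; last by rewrite subrr mulr0.
by rewrite mulf_eq0 (negbTE a0) subr_eq0 => /eqP.
Qed.

(** When the Jost function vanishes, the last step enters a zero and counts nothing, so the count is
    that of Q_0, ..., Q_n, which is the index of the domain by [DP]. *)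
Lemma jost_DP l :
  jost n (ext mu) 1 n.+1 = 0 /\ variations (jost n (ext mu) 1) n.+1 = l <->
  graph (fun x : 'rV[R]_n => Phi x + 1) (D n l) (- mu).
Proof.
have QE : Q (init (- mu)) = jost n (ext mu) 1 n by rewrite /Q Qseq_init // jostE // jost_poly1_Qseq.
have varE : variations (Qseq (ext (init (- mu)))) n = variations (jost n (ext mu) 1) n.
  by apply: eq_variations => k kn; rewrite Qseq_init // jostE // jost_poly1_Qseq.
have variations_last : jost n (ext mu) 1 n.+1 = 0 -> jost n (ext mu) 1 n != 0 ->
    variations (jost n (ext mu) 1) n.+1 = variations (jost n (ext mu) 1) n.
  by move=> e q0; rewrite variationsS e sign_change_pos // mulr0 ltxx addn0.
split=> [[e <-]|[/DP[q0 <-] /(jost_graph q0) e]].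
  have q0 : jost n (ext mu) 1 n != 0.
    by apply: regularS e; apply: jost_regular; rewrite oner_neq0.
  split; last by apply/jost_graph; rewrite // QE.
  by apply/DP; rewrite QE varE variations_last.
by split=> //; rewrite varE variations_last // -QE.
Qed.

Lemma ext_continuous k : {for mu, continuous (fun nu : 'rV[R]_n.+1 => ext nu k)}.
Proof.
rewrite /ext; case: insub => [i|]; first exact: coord_continuous.
exact: (@cst_continuous _ _ (0 : R) mu).
Qed.

(** If the Jost function does not vanish at [mu], the sign count is constant near [mu]; so is the
    trace, which is then continuous there. *)
Lemma virtual_level_jost : virtual_level_at_4 mu -> jost n (ext mu) 1 n.+1 = 0.
Proof.
move=> [E [hE disc]]; apply/eqP/negPn/negP => q0; apply: disc.
have cq k : {for mu, continuous (fun nu : 'rV[R]_n.+1 => jost n (ext nu) 1 k)}.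
  by apply: jost_continuous_potential => i; exact: ext_continuous.
have reg : regular (jost n (ext mu) 1) n.+1 by apply: jost_regular; rewrite oner_neq0.
have := @variations_near_eq _ _ mu (fun nu : 'rV[R]_n.+1 => jost n (ext nu) 1) n.+1
  (fun k _ => cq k) reg q0.
move=> near_var; apply: (@cvg_near_cst _ _ _ _ (nbhs mu)).
by apply: filterS near_var => nu e;
  rewrite (trace_spectral_projection (hE nu)) (trace_spectral_projection (hE mu)) e.
Qed.

Lemma jost_resonance : jost n (ext mu) 1 n.+1 = 0 -> threshold_resonance_at_4 mu.
Proof.
rewrite jost_last => /eqP; rewrite subr_eq0 => /eqP e.
have [C hC] := jost_solution_bound (ext_tail mu) ltr01 e.
exists (cx (jost_solution (ext mu) 1)); split.
- by exists 0%N; rewrite /cx jost_solution0 oner_neq0.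
- exists C => k; have := hC k; rewrite expr1n mulr1 => le.
  by rewrite /cx normc_def /= expr0n /= addr0 sqrtr_sqr lecR.
- rewrite H_cx rH_jost_solution ?oner_neq0 // invr1.
  apply/funext => k; rewrite /cx rmorphM; congr (_ * _).
  have -> : 2 + 1 + 1 = 4 :> R by ring.
  exact: (rmorph_nat (@real_complex R) 4).
Qed.

Lemma eigenvector_re_im (t : R) x : eigenvector (H mu) t x ->
  [/\ rl2 (re x), rl2 (im x), rH (ext mu) (re x) = (fun k => t * re x k)
    & rH (ext mu) (im x) = (fun k => t * im x k)].
Proof.
move=> [/l2P[hr hi] _ e]; split=> //; rewrite -?re_H -?im_H e; apply/funext => k.
  by rewrite /re; case: (x k) => [a b] /=; rewrite mul0r subr0.
by rewrite /im; case: (x k) => [a b] /=; rewrite mul0r addr0.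
Qed.

Lemma H_eigen_unique (t : R) x : H mu x = (fun k => t%:C%C * x k) -> x 0%N = 0 ->
  x = fun=> 0.
Proof.
move=> e x0; apply/re_im_eq; apply/funext => k.
  apply: (@rH_eigen_unique _ (ext mu) t); last by rewrite /re x0.
  rewrite -re_H e; apply/funext => j; rewrite /re; case: (x j) => [a b] /=.
  by rewrite mul0r subr0.
apply: (@rH_eigen_unique _ (ext mu) t); last by rewrite /im x0.
rewrite -im_H e; apply/funext => j; rewrite /im; case: (x j) => [a b] /=.
by rewrite mul0r addr0.
Qed.

(** An eigenvector has a nonzero entry 0; subtracting the multiple that cancels this entry leaves a
    solution that vanishes everywhere. *)
Lemma eigenvalue_simple (t : R) : is_eigenvalue (H mu) t -> is_simple_eigenvalue (H mu) t.
Proof.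
move=> [x ex]; exists x => // y [_ _ ey]; move: ex => [_ [k xk] e].
have x0 : x 0%N != 0.
  by apply: contraNneq xk => /(H_eigen_unique e) ->.
exists (y 0%N / x 0%N); pose d := lincomb (- (y 0%N / x 0%N)) x y.
have d0 : d = fun=> 0.
  apply: (@H_eigen_unique t); last by rewrite /d /lincomb mulNr divfK // addNr.
  by rewrite /d H_lincomb e ey; apply/funext => j; rewrite /lincomb; ring.
apply/funext => j; have := congr1 (@^~ j) d0; rewrite /d /lincomb mulNr addrC => /eqP.
by rewrite subr_eq0 => /eqP.
Qed.

(** An eigenvalue above 4 other than the [t i] would have an eigenvector orthogonal to all the
    [v i]; its real or imaginary part would have a positive form, against maximality. *)
Lemma eigenvalue_count :
  ([set t : R | 4 < t /\ is_eigenvalue (H mu) t] #= `I_(variations (jost n (ext mu) 1) n.+1))%card.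
Proof.
have [v [t [hv t_inj max]]] := threshold_eigenbasis (ext_tail mu).
set s := variations _ _ in v t hv t_inj max *.
have -> : [set t0 : R | 4 < t0 /\ is_eigenvalue (H mu) t0] = t @` [set: 'I_s].
  apply/seteqP; split=> [t0 [t04 [x ex]]|_ [i _ <-]]; last first.
    have [vl v0 t4 ev] := hv i; split=> //; exists (cx (v i)); split.
    - exact: l2_cx.
    - by exists 0%N; rewrite /cx v0 oner_neq0.
    - by rewrite H_cx ev; apply/funext => k; rewrite /cx rmorphM.
  apply: contrapT => nt.
  have zero u : rl2 u -> rH (ext mu) u = (fun k => t0 * u k) -> u = fun=> 0.
    move=> hu eu; apply/funext => k; apply/eqP/negPn/negP => uk.
    have := max u hu; rewrite (rform_eigenr _ _ eu) // leNgt.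
    rewrite mulr_gt0 ?subr_gt0 //; last exact: rdot_gt0 uk.
    have orth i : rdot (v i) u = 0.
      have [vl _ _ ev] := hv i; apply: (rH_eigen_orth (ext_tail mu) vl hu ev eu).
      by apply/eqP => e; apply: nt; exists i.
    by move/(_ orth).
  have [hr hi er ei] := eigenvector_re_im ex.
  have [_ [k /eqP xk] _] := ex; apply: xk.
  by rewrite (re_im_eq (y := fun=> 0) (zero _ hr er) (zero _ hi ei)).
rewrite card_eq_sym (card_eql card_II) card_eq_sym.
by apply: inj_card_eq => i j _ _; exact: t_inj.
Qed.

End conclusion.

Theorem theorem6p4 (R : realType) (n : nat) (mu : 'rV[R]_n.+1) :
  virtual_level_at_4 mu ->
  (exists! l : nat,
      (l <= n)%N /\ graph (fun x : 'rV[R]_n => Phi x + 1) (D n l) (- mu)) /\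
  (forall l : nat,
      (l <= n)%N /\ graph (fun x : 'rV[R]_n => Phi x + 1) (D n l) (- mu) ->
      threshold_resonance_at_4 mu /\
      ([set t : R | 4 < t /\ is_eigenvalue (H mu) t] #= `I_l)%card /\
      (forall t : R, 4 < t -> is_eigenvalue (H mu) t ->
         is_simple_eigenvalue (H mu) t)).
Proof.
move=> /virtual_level_jost e; split.
  (* Uniqueness is immediate, as [jost_DP] identifies any admissible index with the sign count. *)
  exists (variations (jost n (ext mu) 1) n.+1); split=> [|l [_ /jost_DP[]]] //.
  have gr := (jost_DP mu _).1 (conj e erefl); split=> //.
  by case: gr => /DP[_ <-] _; exact: variations_le.
move=> l [_ /jost_DP[_ <-]]; split; first exact: jost_resonance.
by split=> [|t _]; [exact: eigenvalue_count|exact: eigenvalue_simple].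
Qed.
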